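(* Let $\rho>0$ and let $\{P_n(\cdot;\rho)\}_{n\ge 0}$ be the threefold symmetric polynomial sequence defined by $P_0(x)=1$, $P_1(x)=x$, $P_2(x)=x^2$ and $P_{n+1}(x)=xP_n(x)-\gamma_{n-1}P_{n-2}(x)$ for $n\ge 2$, where $$\gamma_{2n}=\frac{2n(2n+1)}{3(3n+\rho)}\quad (n\ge 1),\qquad \gamma_{2n+1}=\frac{2(n+1)(2n+1)(n+\rho)}{3(3n+\rho)(3n+\rho+3)}\quad (n\ge 0).$$ Then $\{P_n(\cdot;\rho)\}_{n\ge0}$ is $2$-orthogonal with respect to the pair of linear functionals $(u_0,u_1)$ given, for every polynomial $f$ and $k=0,1$, by $$\langle u_k,f\rangle=\frac13\left(\int_0^{\infty}f(x)\,\mathcal U_k(x)\,dx+\omega^{2k-1}\int_0^{\infty\omega}f(x)\,\mathcal U_k(\omega^2x)\,dx+\omega^{1-2k}\int_0^{\infty\omega^2}f(x)\,\mathcal U_k(\omega x)\,dx\right),$$ where $\omega=e^{2\pi i/3}$ and, for $x>0$, $$\mathcal U_0(x)=\frac{3\,\Gamma(\frac{\rho+3}{3})}{\Gamma(\frac13)\Gamma(\frac23)}\,e^{-x^3}\,\mathbf U\!\left(\tfrac{\rho+1}{3},\tfrac23;x^3\right),\qquad \mathcal U_1(x)=\frac{9\,\Gamma(\frac{\rho+3}{3})}{\Gamma(\frac13)\Gamma(\frac23)}\,x^2e^{-x^3}\,\mathbf U\!\left(\tfrac{\rho+1}{3},\tfrac53;x^3\right).$$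
   Context: $\mathbf U(a,b;x)$ is the Kummer (confluent hypergeometric) function of the second kind; for $\Re a>0$ and $|\arg x|<\pi/2$, $\mathbf U(a,b;x)=\frac1{\Gamma(a)}\int_0^\infty t^{a-1}(t+1)^{b-a-1}e^{-tx}\,dt$. The integrals $\int_0^{\infty\omega^j}$ are along the rays $\{t\omega^j:t\ge0\}$, on which the arguments $\omega^2x$, $\omega x$ of $\mathcal U_k$ are nonnegative reals. A sequence of monic polynomials $\{P_n\}_{n\ge0}$ ($\deg P_n=n$) is $2$-orthogonal with respect to $(u_0,u_1)$ if for all $m,n\ge 0$: $\langle u_0,x^mP_n\rangle=0$ if $n\ge 2m+1$ and $\langle u_0,x^mP_{2m}\rangle\neq 0$; $\langle u_1,x^mP_n\rangle=0$ if $n\ge 2m+2$ and $\langle u_1,x^mP_{2m+1}\rangle\ne 0$. Threefold symmetric means $P_n(\omega x)=\omega^nP_n(x)$ for all $n$. *)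

(* Defs.v *)
From HB Require Import structures.
From mathcomp Require Import all_boot all_order all_algebra.
From mathcomp Require Import all_classical all_reals all_analysis.
From mathcomp.real_closed Require Export complex.

Set Implicit Arguments.
Unset Strict Implicit.
Unset Printing Implicit Defensive.

Import Order.TTheory GRing.Theory Num.Theory.

Local Open Scope classical_set_scope.
Local Open Scope ring_scope.
Local Open Scope complex_scope.

Section SpecialFunctions.
Context {R : realType}.
Implicit Types a b x : R.

(* Euler's integral; meaningful for a > 0. *)
Definition Gamma a : R :=
  \int[lebesgue_measure]_(t in `]0, +oo[) (t `^ (a - 1) * expR (- t)).

(* Kummer's function of the second kind, by its integral representation;
   meaningful for a > 0 and x > 0. *)
Definition kummerU a b x : R :=
  (Gamma a)^-1 *
  \int[lebesgue_measure]_(t in `]0, +oo[)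
    (t `^ (a - 1) * (t + 1) `^ (b - a - 1) * expR (- (t * x))).

End SpecialFunctions.

Section RayIntegrals.
Context {R : realType}.
Implicit Types (zeta : R[i]) (g : R[i] -> R[i]).

Definition omega : R[i] := cos (2 * pi / 3) +i* sin (2 * pi / 3).

(* The ray {t * zeta : t > 0} is parametrized by t, so that dx = zeta dt. *)
Definition ray_pullback zeta g (t : R) : R[i] := g (t%:C * zeta) * zeta.

Definition ray_integrable zeta g : Prop :=
  lebesgue_measure.-integrable `]0, +oo[
    (fun t : R => (complex.Re (ray_pullback zeta g t))%:E) /\
  lebesgue_measure.-integrable `]0, +oo[
    (fun t : R => (complex.Im (ray_pullback zeta g t))%:E).

Definition ray_integral zeta g : R[i] :=
  (\int[lebesgue_measure]_(t in `]0, +oo[) complex.Re (ray_pullback zeta g t)) +i*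
  (\int[lebesgue_measure]_(t in `]0, +oo[) complex.Im (ray_pullback zeta g t)).

End RayIntegrals.

Section Functionals.
Context {R : realType}.
Implicit Types (U : R -> R) (c : R[i]) (f : {poly R[i]}).

(* x |-> f(x) U(c x).  It is only integrated along the ray on which c x is a
   positive real, where taking the real part of c x loses nothing. *)
Definition weighted U c f (x : R[i]) : R[i] := f.[x] * (U (complex.Re (c * x)))%:C.

Definition functional (k : nat) U f : R[i] :=
  3^-1 *
  (ray_integral 1 (weighted U 1 f)
   + omega ^ (2 * k%:Z - 1) * ray_integral omega (weighted U (omega ^+ 2) f)
   + omega ^ (1 - 2 * k%:Z) * ray_integral (omega ^+ 2) (weighted U omega f)).

Definition functional_converges U f : Prop :=
  [/\ ray_integrable 1 (weighted U 1 f),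
      ray_integrable omega (weighted U (omega ^+ 2) f) &
      ray_integrable (omega ^+ 2) (weighted U omega f)].

Definition calU0 (rho x : R) : R :=
  3 * Gamma ((rho + 3) / 3) / (Gamma (1 / 3) * Gamma (2 / 3)) *
  expR (- x ^+ 3) * kummerU ((rho + 1) / 3) (2 / 3) (x ^+ 3).

Definition calU1 (rho x : R) : R :=
  9 * Gamma ((rho + 3) / 3) / (Gamma (1 / 3) * Gamma (2 / 3)) *
  x ^+ 2 * expR (- x ^+ 3) * kummerU ((rho + 1) / 3) (5 / 3) (x ^+ 3).

End Functionals.

Section TwoOrthogonality.
Context {R : realType}.
Implicit Types (P : nat -> {poly R[i]}) (u : {poly R[i]} -> R[i]).

Definition monic_sequence P : Prop :=
  forall n, P n \is monic /\ size (P n) = n.+1.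

Definition threefold_symmetric P : Prop :=
  forall n (x : R[i]), (P n).[omega * x] = omega ^+ n * (P n).[x].

Definition two_orthogonal P u0 u1 : Prop :=
  [/\ monic_sequence P, scalar u0, scalar u1,
      forall m : nat,
        (forall n : nat, (2 * m + 1 <= n)%N -> u0 ('X^m * P n) = 0) /\
        u0 ('X^m * P (2 * m)%N) != 0 &
      forall m : nat,
        (forall n : nat, (2 * m + 2 <= n)%N -> u1 ('X^m * P n) = 0) /\
        u1 ('X^m * P (2 * m + 1)%N) != 0].

End TwoOrthogonality.

(* Main.v *)
(** Integrating the Kummer weight against t^n and exchanging the integrals
    (Tonelli) factors the n-th moment on the half-line as a constant times
    K(m) J(c), where K(m) is the integral of t^m exp(-t^3) and J(c) that of
    v^(a-1) (1+v)^(-a-c), with a = (rho+1)/3.  Integration by parts gives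
    3 K(m+3) = (m+1) K(m) and c J(c) = (a+c) J(c+1), and the cube roots of
    unity kill all moments outside one class mod 3.  Hence, up to nonzero
    factors, u_k(x^(3j+k)) is (3j+k)! / (27^j j! (rho/3+1)_j) and the other
    moments vanish.

    On the other side the recurrence is solved explicitly: with
    T = rho/3 + floor((N-1)/2), the coefficient of x^(N-3k) in P_N is
    (-1)^k N! / ((N-3k)! k! 27^k T(T-1)...(T-k+1)).  Therefore u_k(P_(3n+k)) is
    a multiple of sum_j (-1)^j C(n,j) q(j) with q a polynomial of degree < n,
    which is zero as an n-th finite difference.  Orthogonality against x^m then
    follows from the recurrence by induction on m, since all gamma_n > 0. *)

Require Import Defs.
From HB Require Import structures.
From mathcomp Require Import all_boot all_order all_algebra.
From mathcomp Require Import all_classical all_reals all_analysis.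
From mathcomp Require Import measurable_realfun.
From mathcomp.real_closed Require Import complex.
From mathcomp Require Import ring lra zify.
Import Order.TTheory GRing.Theory Num.Theory.
Import numFieldNormedType.Exports.
Local Open Scope classical_set_scope.
Local Open Scope ring_scope.

(** * Integration over the open half-line *)

Section HalfLine.
Context {R : realType}.
Notation mu := (@lebesgue_measure R).
Implicit Types (f F : R -> R).

Lemma measurable_fun_halfline {f} : (forall x : R, 0 < x -> {for x, continuous f}) ->
  measurable_fun (`]0, +oo[%classic : set R) f.
Proof.
move=> cf; apply: open_continuous_measurable_fun => //= x.
by rewrite inE/= in_itv/= andbT; exact: cf.
Qed.

(** Compact segments exhausting the open half-line, so that no regularity at 0 is asked of the
    integrands. The offset in [n.+2] keeps even the segment for [n = 0] nondegenerate. *)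
Let seg (n : nat) : set R := `[(n.+1%:R)^-1, n.+2%:R]%classic.

Let seg_gt0 n x : seg n x -> 0 < x.
Proof.
by rewrite /seg/= in_itv/= => /andP[+ _]; apply: lt_le_trans; rewrite invr_gt0.
Qed.

Let nd_seg : nondecreasing_seq seg.
Proof.
move=> m n mn; apply/subsetPset => x; rewrite /seg/= !in_itv/= => /andP[a b].
apply/andP; split; last by rewrite (le_trans b)// ler_nat; lia.
by rewrite (le_trans _ a)// lef_pV2 ?posrE// ler_nat; lia.
Qed.

Let bigcup_seg : \bigcup_n seg n = `]0, +oo[%classic.
Proof.
apply/seteqP; split => x /=.
  by move=> [n _ /seg_gt0]; rewrite in_itv/= andbT.
rewrite in_itv/= andbT => x0.
exists (Num.truncn (x^-1) + Num.truncn x)%N => //; rewrite /seg/= in_itv/=.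
have xV0 : 0 < x^-1 by rewrite invr_gt0.
apply/andP; split.
  by rewrite invf_ple ?posrE// (le_trans (ltW (truncnS_gt _)))// ler_nat ltnS leq_addr.
by rewrite (le_trans (ltW (truncnS_gt _)))// ler_nat ltnS leqW// leq_addl.
Qed.

(* The identity holds in the extended reals, so finiteness of one integral
   yields finiteness of the other. *)
Lemma integral_halfline_FTC {f1 f2 F} {l0 l1 : R} :
  (forall x : R, 0 < x -> 0 <= f1 x) -> (forall x : R, 0 < x -> 0 <= f2 x) ->
  (forall x : R, 0 < x -> {for x, continuous f1}) ->
  (forall x : R, 0 < x -> {for x, continuous f2}) ->
  (forall x : R, 0 < x -> is_derive x (1 : R) F (f1 x - f2 x)) ->
  F x @[x --> 0^'+] --> l0 -> F x @[x --> +oo] --> l1 ->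
  (\int[mu]_(x in `]0%R, +oo[) (f1 x)%:E =
   \int[mu]_(x in `]0%R, +oo[) (f2 x)%:E + (l1 - l0)%:E)%E.
Proof.
move=> f1_0 f2_0 cf1 cf2 dF F0 Foo.
have mseg i : measurable (seg i) by exact: measurable_itv.
have msub f : (forall x : R, 0 < x -> {for x, continuous f}) ->
    forall i, measurable_fun (seg i) (EFin \o f).
  move=> cf i; apply/measurable_EFinP.
  apply: measurable_funS (measurable_fun_halfline cf) => //.
  by rewrite -bigcup_seg; apply: bigcup_sup.
have cvgI f : (forall x : R, 0 < x -> 0 <= f x) ->
    (forall x : R, 0 < x -> {for x, continuous f}) ->
    (\int[mu]_(x in seg i) (f x)%:E @[i --> \oo] --> \int[mu]_(x in `]0%R, +oo[) (f x)%:E)%E.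
  move=> f0 cf; rewrite -bigcup_seg.
  apply: (@ge0_nondecreasing_set_cvg_integral _ (measurableTypeR R)) => //.
  - exact: msub.
  - by move=> i x /seg_gt0 x0; rewrite lee_fin f0.
have wc f n : (forall x : R, 0 < x -> {for x, continuous f}) -> {within seg n, continuous f}.
  move=> cf; apply: continuous_in_subspaceT => x; rewrite inE => /seg_gt0; exact: cf.
have intseg f n : (forall x : R, 0 < x -> {for x, continuous f}) ->
    mu.-integrable (seg n) (EFin \o f).
  by move=> cf; apply: continuous_compact_integrable; [exact: segment_compact|exact: wc].
have fin f n : (forall x : R, 0 < x -> {for x, continuous f}) ->
   (\int[mu]_(x in seg n) (f x)%:E)%E \is a fin_num.
  by move=> cf; have := intseg f n cf; apply: integrable_fin_num; exact: measurable_itv.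
have cF x : 0 < x -> {for x, continuous F}.
  by move=> /dF[d _]; apply: differentiable_continuous; exact/derivable1_diffP.
(* On a segment both integrals are finite, so the fundamental theorem for [f1 - f2] can be split and
   the [f2] term moved across. *)
have E n : (\int[mu]_(x in seg n) (f1 x)%:E =
    \int[mu]_(x in seg n) (f2 x)%:E + (F n.+2%:R - F (n.+1%:R)^-1)%:E)%E.
  rewrite EFinB -(@continuous_FTC2 _ (f1 \- f2) F) //; last 4 first.
  - by rewrite (@le_lt_trans _ _ 1)// ?ltr1n// invf_le1 ?ler1n.
  - apply: wc => x x0; apply: cvgB; [exact: cf1|exact: cf2].
  - have n1 : 0 < n.+1%:R^-1 :> R by rewrite invr_gt0.
    split.
    + move=> x; rewrite in_itv/= => /andP[x0 _].
      by have [] := dF x (lt_trans n1 x0).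
    + exact/cvg_at_right_filter/cF.
    + exact/cvg_at_left_filter/cF.
  - move=> x; rewrite in_itv/= => /andP[+ _].
    have n1 : 0 < n.+1%:R^-1 :> R by rewrite invr_gt0.
    by move=> /(lt_trans n1)/dF[? <-]; rewrite derive1E.
  under [X in (_ + X)%E]eq_integral do rewrite EFinB.
  rewrite integralB_EFin//; [|exact: intseg..].
  by rewrite addeC subeK// fin.
(* Both sides of [E] converge as [n] grows, the integrals by monotone convergence; uniqueness of the
   limit concludes. *)
have := cvgI _ f1_0 cf1; under eq_cvg do rewrite E.
move=> /cvg_unique; apply => //; apply: cvgeD.
- by rewrite fin_num_adde_defl.
- exact: cvgI.
- apply: cvg_EFin; first exact: nearW.
  apply: cvgB.
    apply: ((cvg_pinftyP F l1).1 Foo); apply/cvgryPge => r.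
    near=> n; rewrite (@le_trans _ _ n%:R)//; last by rewrite ler_nat; lia.
    by near: n; exact: nbhs_infty_ger.
  apply: ((cvg_at_rightP F 0 l0).1 F0); split; first by move=> n; rewrite invr_gt0.
  exact: cvg_harmonic.
Unshelve. all: by end_near. Qed.

(** A vanishing integral would force [f = 0] almost everywhere; as [f] has no zero there, the
    half-line would sit inside a null set, against its infinite measure. *)
Lemma integral_halfline_gt0 f : (forall x : R, 0 < x -> 0 < f x) ->
  (forall x : R, 0 < x -> {for x, continuous f}) ->
  (0 < \int[mu]_(x in `]0%R, +oo[) (f x)%:E)%E.
Proof.
move=> f0 cf; rewrite lt0e integral_ge0 ?andbT; last first.
  by move=> x; rewrite /= in_itv/= andbT lee_fin => /f0/ltW.
apply/eqP => If0.
have mf : measurable_fun (`]0, +oo[%classic : set R) (EFin \o f).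
  by apply/measurable_EFinP; exact: measurable_fun_halfline.
have [+ _] := ae_eq_integral_abs mu (measurable_itv `]0%R, +oo[) mf.
case=> [|N [mN N0 sub]].
  rewrite -[RHS]If0; apply: eq_integral => x.
  by rewrite inE/= in_itv/= andbT => /f0/ltW ?; rewrite ger0_norm.
have : (mu `]0%R, +oo[ <= mu N)%E.
  apply: le_measure; rewrite ?inE//=; apply: subset_trans sub => x /= x0 /(_ x0) /eqP.
  by move: x0; rewrite in_itv/= andbT => /f0 fx; rewrite eqe gt_eqF.
by rewrite lebesgue_measure_itv/= N0 ltey.
Qed.

End HalfLine.

(** * The beta integral *)

Section PowerFunctions.
Context {R : realType}.
Notation mu := (@lebesgue_measure R).
Implicit Types a b c v x : R.

Lemma is_derive_for_continuous (f : R -> R) x df :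
  is_derive x (1 : R) f df -> {for x, continuous f}.
Proof. by case=> d _; apply: differentiable_continuous; exact/derivable1_diffP. Qed.

Lemma is_derive1_powRD1 b x : 0 <= x ->
  is_derive x (1 : R) (fun v => (v + 1) `^ b) (b * (x + 1) `^ (b - 1)).
Proof.
move=> x0; have x1 : 0 < x + 1 by rewrite ltr_wpDl.
have h : is_derive x (1 : R) (fun v => v + 1) 1.
  by apply: is_derive_eq; rewrite addr0.
have := @is_derive1_comp R (@powR R ^~ b) (fun v : R => v + 1) x _ _ (is_derive1_powR b x1) h.
by rewrite mulr1.
Qed.

Lemma continuous_powR a x : 0 < x -> {for x, continuous (@powR R ^~ a)}.
Proof. by move=> x0; exact: is_derive_for_continuous (is_derive1_powR a x0). Qed.

Lemma continuous_powRD1 a x : 0 <= x -> {for x, continuous (fun v => (v + 1) `^ a)}.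
Proof. by move=> x0; exact: is_derive_for_continuous (is_derive1_powRD1 a x x0). Qed.

Lemma cvgy_powRD1N c : 0 < c -> (v + 1) `^ (- c) @[v --> +oo] --> 0.
Proof.
move=> c0; apply/cvgr0Pnorm_le => /= e e0; near=> v.
have v1 : 0 < v + 1 by near: v; exists 0; split => // x x0; rewrite addr_gt0.
rewrite ger0_norm ?powR_ge0// powRN invf_ple ?posrE ?powR_gt0//.
(* The threshold for [v] is [e^-1] to the power [1/c]. *)
have -> : e^-1 = (e^-1 `^ c^-1) `^ c.
  by rewrite -powRrM mulVf ?lt0r_neq0// powRr1// invr_ge0 ltW.
rewrite ge0_ler_powR ?nnegrE ?powR_ge0 ?(ltW c0) ?(ltW v1)//.
rewrite (@le_trans _ _ v) ?lerDl//; near: v; exact: nbhs_pinfty_ge.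
Unshelve. all: by end_near. Qed.

Lemma powR_addr1 x a : 0 < x -> x `^ (a + 1) = x * x `^ a.
Proof. by move=> x0; rewrite powRD ?lt0r_neq0 ?implybT// powRr1 ?ltW// mulrC. Qed.

End PowerFunctions.

Section BetaIntegral.
Context {R : realType}.
Notation mu := (@lebesgue_measure R).
Implicit Types a b c v x : R.

(** The integrand of Euler's beta function B(a, c), carried from the unit interval to the half-line
    by u = v/(1+v). *)
Definition beta_density a c v : R := v `^ (a - 1) * (v + 1) `^ (- (a + c)).

Definition beta_integral a c : \bar R :=
  \int[mu]_(v in `]0, +oo[) (beta_density a c v)%:E.

Lemma beta_density_gt0 a c v : 0 < v -> 0 < beta_density a c v.
Proof. by move=> v0; rewrite mulr_gt0// powR_gt0// addr_gt0. Qed.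

Lemma continuous_beta_density a c v : 0 < v ->
  {for v, continuous (beta_density a c)}.
Proof.
move=> v0; apply: cvgM; first exact: continuous_powR.
exact/continuous_powRD1/ltW.
Qed.

Lemma beta_integral_gt0 a c : (0 < beta_integral a c)%E.
Proof.
apply: integral_halfline_gt0 => v v0; first exact: beta_density_gt0.
exact: continuous_beta_density.
Qed.

(** One primitive serves twice: for [c > 0] it vanishes at both ends and gives the recurrence in
    [c], while for [c = 0] it is (v/(v+1))^a, which rises from 0 to 1. *)
Let primitive a c v : R := v `^ a * (v + 1) `^ (- (a + c)).

Let primitive_derive a c v : 0 < v ->
  is_derive v (1 : R) (primitive a c)
   ((a + c) * beta_density a (c + 1) v - c * beta_density a c v).
Proof.
move=> v0; have v1 : 0 < v + 1 by rewrite addr_gt0.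
have d1 := is_derive1_powR a v0; have d2 := is_derive1_powRD1 (- (a + c)) v (ltW v0).
apply: (is_derive_eq (is_deriveM d1 d2)).
rewrite /beta_density -![_ *: _]/(_ * _) /=.
have -> : v `^ a = v * v `^ (a - 1) by rewrite -powR_addr1// subrK.
have -> : (v + 1) `^ (- (a + c)) = (v + 1) * (v + 1) `^ (- (a + c) - 1).
  by rewrite -powR_addr1// subrK.
rewrite (_ : - (a + (c + 1)) = - (a + c) - 1); last ring.
by rewrite /=; ring.
Qed.

Let primitive_cvg0 a c : 0 < a -> primitive a c v @[v --> 0^'+] --> 0.
Proof.
move=> a0; rewrite -[X in _ --> X](mul0r ((0 + 1) `^ (- (a + c)))).
apply: cvgM; first exact: powR_cvg0.
exact/cvg_at_right_filter/continuous_powRD1.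
Qed.

Let integral_scale a c k : 0 <= k ->
  (\int[mu]_(v in `]0%R, +oo[) (k * beta_density a c v)%:E =
   k%:E * beta_integral a c)%E.
Proof.
move=> k0; under eq_integral do rewrite EFinM.
rewrite ge0_integralZl_EFin//.
  by move=> v; rewrite /= in_itv/= andbT => /(beta_density_gt0 a c)/ltW; rewrite lee_fin.
apply/measurable_EFinP; apply: measurable_fun_halfline => x; exact: continuous_beta_density.
Qed.

Lemma beta_integral_rec a c : 0 < a -> 0 < c ->
  (c%:E * beta_integral a c = (a + c)%:E * beta_integral a (c + 1))%E.
Proof.
move=> a0 c0; have ac0 : 0 < a + c by rewrite addr_gt0.
rewrite -!integral_scale ?ltW//; apply/esym.
have ge0 k c' v : 0 < k -> 0 < v -> 0 <= k * beta_density a c' v.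
  by move=> k0 v0; rewrite mulr_ge0 ?ltW// beta_density_gt0.
have cts k c' v : 0 < v -> {for v, continuous (fun v => k * beta_density a c' v)}.
  by move=> v0; apply: cvgM; [exact: cvg_cst|exact: continuous_beta_density].
(* Since v^a is at most (v+1)^a, the primitive is squeezed below (v+1)^(-c). *)
have oo : primitive a c v @[v --> +oo] --> 0.
  apply: (squeeze_cvgr _ (cvg_cst 0) (cvgy_powRD1N c c0)); near=> v.
  have v0 : 0 < v by near: v; exact: nbhs_pinfty_gt.
  rewrite /primitive mulr_ge0 ?powR_ge0//= opprD powRD; last by rewrite lt0r_neq0 ?implybT ?addr_gt0.
  rewrite mulrA ler_piMl ?powR_ge0// powRN ler_pdivrMr ?powR_gt0 ?addr_gt0// mul1r.
  by rewrite ge0_ler_powR ?nnegrE ?lerDl ?ltW ?addr_gt0.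
have := integral_halfline_FTC (fun v => ge0 _ (c + 1) v ac0) (fun v => ge0 _ c v c0)
  (cts _ _) (cts _ _) (primitive_derive a c) (primitive_cvg0 a c a0) oo.
by rewrite subrr adde0.
Unshelve. all: by end_near. Qed.

Lemma beta_integral1 a : 0 < a -> (a%:E * beta_integral a 1 = 1)%E.
Proof.
move=> a0; rewrite -integral_scale ?ltW//.
(* The base v/(v+1) is written as 1 - 1/(v+1). *)
have oo : primitive a 0 v @[v --> +oo] --> (1 : R).
  have : (1 - (v + 1) `^ (- 1)) `^ a @[v --> +oo] --> ((1 - 0) `^ a : R).
    apply: (@cvg_comp _ _ _ (fun v => 1 - (v + 1) `^ (- 1)) (@powR R ^~ a)).
      by apply: cvgB; [exact: cvg_cst|exact: cvgy_powRD1N].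
    by rewrite subr0; exact: continuous_powR.
  rewrite subr0 powR1; apply: cvg_trans; apply: near_eq_cvg; near=> v.
  have v0 : 0 < v by near: v; exact: nbhs_pinfty_gt.
  have v1 : 0 < v + 1 by rewrite addr_gt0.
  rewrite /primitive addr0 powRN powR_inv1 ?ltW//.
  have -> : 1 - (v + 1)^-1 = v * (v + 1)^-1 by field; rewrite gt_eqF.
  by rewrite powRM ?invr_ge0 ?ltW// -powR_inv1 ?ltW// -powRrM mulN1r powRN.
have := @integral_halfline_FTC _ (fun v => a * beta_density a 1 v) (cst 0)
  (primitive a 0) 0 1.
rewrite integral0 add0e subr0; apply => //.
- by move=> v v0; rewrite mulr_ge0 ?ltW// beta_density_gt0.
- by move=> v v0; apply: cvgM; [exact: cvg_cst|exact: continuous_beta_density].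
- by move=> v v0; exact: cvg_cst.
- move=> v v0; have := primitive_derive a 0 v v0.
  by rewrite !addr0 add0r mul0r.
- exact: primitive_cvg0.
Unshelve. all: by end_near. Qed.

(** The value at 1 is [1/a], and the density at [c + 1] is dominated by the one at 1. The recurrence
    then carries finiteness from [c + 1] down to [c], which covers [c < 1]. *)
Lemma beta_integral_lty a c : 0 < a -> 0 < c -> (beta_integral a c < +oo)%E.
Proof.
move=> a0 c0.
have fin1 : (beta_integral a 1 < +oo)%E.
  rewrite ltey; apply/eqP => h; have := beta_integral1 a a0.
  by rewrite h mulry gtr0_sg// mul1e.
have le1 : (beta_integral a (c + 1) <= beta_integral a 1)%E.
  apply: ge0_le_integral => //=.
  - by move=> v; rewrite in_itv/= andbT => /(beta_density_gt0 a (c + 1))/ltW; rewrite lee_fin.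
  - apply/measurable_EFinP; apply: measurable_fun_halfline => x; exact: continuous_beta_density.
  - apply/measurable_EFinP; apply: measurable_fun_halfline => x; exact: continuous_beta_density.
  - move=> v; rewrite in_itv/= andbT => v0; rewrite lee_fin ler_wpM2l ?powR_ge0//.
    by rewrite ler_powR//; lra.
rewrite ltey; apply/eqP => h; have := beta_integral_rec a c a0 c0.
rewrite h mulry gtr0_sg// mul1e => h'.
have : (beta_integral a (c + 1) < +oo)%E by exact: le_lt_trans fin1.
by move=> /(lte_mul_pinfty (ltW (addr_gt0 a0 c0 : 0 < (a + c)%:E)%E)) => /(_ isT); rewrite -h' ltxx.
Qed.

End BetaIntegral.

(** * Gamma and cubic exponential integrals *)

Section GammaIntegral.
Context {R : realType}.
Notation mu := (@lebesgue_measure R).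
Implicit Types a m t : R.

(** Raise t + 1 <= m (1 + t/m) <= m exp(t/m) to the power [m]. *)
Lemma powRD1_le_expR m t : 1 <= m -> 0 <= t -> (t + 1) `^ m <= m `^ m * expR t.
Proof.
move=> m1 t0; have m0 : 0 < m by exact: lt_le_trans m1.
have -> : expR t = expR (t / m) `^ m by rewrite -expRM divfK ?lt0r_neq0.
rewrite -powRM ?expR_ge0 ?(ltW m0)//.
rewrite ge0_ler_powR ?nnegrE ?mulr_ge0 ?expR_ge0 ?addr_ge0 ?(ltW m0)//.
rewrite (@le_trans _ _ (m * (1 + t / m)))//.
  by rewrite mulrDr mulr1 mulrCA divff ?lt0r_neq0// mulr1 addrC lerD2r.
by rewrite ler_wpM2l ?(ltW m0)// expR_ge1Dx.
Qed.

Let gamma_density a t := t `^ (a - 1) * expR (- t).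

Let gamma_density_gt0 a t : 0 < t -> 0 < gamma_density a t.
Proof. by move=> t0; rewrite mulr_gt0 ?powR_gt0 ?expR_gt0. Qed.

Let continuous_gamma_density a t : 0 < t -> {for t, continuous (gamma_density a)}.
Proof.
move=> t0; apply: cvgM; first exact: continuous_powR.
by apply: (@continuous_comp _ _ _ -%R expR); [exact: opp_continuous|exact: continuous_expR].
Qed.

(** The exponential is dominated by a constant times (t+1)^(-(a+1)), which reduces the claim to the
    beta integral with [c = 1]. *)
Lemma Gamma_integral_lty a : 0 < a ->
  (\int[mu]_(t in `]0%R, +oo[) (t `^ (a - 1) * expR (- t))%:E < +oo)%E.
Proof.
move=> a0; have m0 : 0 <= (a + 1) `^ (a + 1) by exact: powR_ge0.
apply: (@le_lt_trans _ _ ((((a + 1) `^ (a + 1))%:E * beta_integral a 1)%E)); last first.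
  by rewrite lte_mul_pinfty ?lee_fin ?beta_integral_lty.
rewrite -ge0_integralZl_EFin//; last 2 first.
- by move=> v; rewrite /= in_itv/= andbT => /(beta_density_gt0 a 1)/ltW; rewrite lee_fin.
- apply/measurable_EFinP; apply: measurable_fun_halfline => x; exact: continuous_beta_density.
apply: ge0_le_integral => //=.
- by move=> t; rewrite in_itv/= andbT => /(gamma_density_gt0 a)/ltW; rewrite lee_fin.
- by apply/measurable_EFinP; apply: measurable_fun_halfline => x; exact: continuous_gamma_density.
- apply: measurable_funeM.
  by apply/measurable_EFinP; apply: measurable_fun_halfline => x; exact: continuous_beta_density.
- move=> t; rewrite in_itv/= andbT => t0; rewrite -EFinM lee_fin mulrCA ler_wpM2l ?powR_ge0//.
  rewrite powRN ler_pdivlMr ?powR_gt0 ?addr_gt0// expRN mulrC ler_pdivrMr ?expR_gt0//.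
  by rewrite powRD1_le_expR ?lerDr ?ltW.
Qed.

Lemma Gamma_gt0 a : 0 < a -> 0 < Gamma a.
Proof.
move=> a0; rewrite /Gamma/Rintegral fine_gt0// Gamma_integral_lty// andbT.
apply: integral_halfline_gt0 => t t0; first exact: gamma_density_gt0.
exact: continuous_gamma_density.
Qed.

End GammaIntegral.

Section CubicExponential.
Context {R : realType}.
Notation mu := (@lebesgue_measure R).
Implicit Types l t : R.

Definition cubic_density n t : R := t ^+ n * expR (- t ^+ 3).

Definition cubic_moment n : \bar R :=
  \int[mu]_(t in `]0, +oo[) (cubic_density n t)%:E.

Lemma cubic_density_gt0 n t : 0 < t -> 0 < cubic_density n t.
Proof. by move=> t0; rewrite mulr_gt0 ?exprn_gt0 ?expR_gt0. Qed.

Let is_derive_cubic n t : is_derive t (1 : R) (cubic_density n)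
  (n%:R * t ^+ n.-1 * expR (- t ^+ 3) - 3 * cubic_density n.+2 t).
Proof.
have dX m : is_derive t (1 : R) (fun x => x ^+ m) (m%:R * t ^+ m.-1).
  by split; [exact: exprn_derivable|rewrite -derive1E exp_derive1].
apply: (is_derive_eq (is_deriveM (dX n) (@is_derive1_comp R expR
  (- (fun x => x ^+ 3)) t _ _ (is_derive_expR _) (is_deriveN (dX 3%N))))).
rewrite /cubic_density -![_ *: _]/(_ * _) /= (_ : (- _) t = - t ^+ 3) // !exprS; ring.
Qed.

Lemma continuous_cubic_density n : continuous (cubic_density n).
Proof. by move=> t; exact: is_derive_for_continuous (is_derive_cubic n t). Qed.

Lemma cubic_moment_gt0 n : (0 < cubic_moment n)%E.
Proof.
apply: integral_halfline_gt0 => t t0; first exact: cubic_density_gt0.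
exact: continuous_cubic_density.
Qed.

(** The exponents satisfy -t^3 <= 1 - t: for [t <= 1] the right side is nonnegative, and for
    [t >= 1] one has t <= t^3. *)
Let expR_cube_le t : 0 <= t -> expR (- t ^+ 3) <= expR 1 * expR (- t).
Proof.
move=> t0; rewrite -expRD ler_expR; have [t1|/ltW t1] := leP t 1.
  by have := exprn_ge0 3 t0; lra.
suff : t ^+ 1 <= t ^+ 3 by rewrite expr1; lra.
exact: ler_weXn2l.
Qed.

Lemma cubic_moment_lty n : (cubic_moment n < +oo)%E.
Proof.
have n0 : 0 < n.+1%:R :> R by [].
apply: (@le_lt_trans _ _ ((expR 1)%:E * \int[mu]_(t in `]0%R, +oo[)
   (t `^ (n.+1%:R - 1) * expR (- t))%:E)%E); last first.
  by rewrite lte_mul_pinfty ?lee_fin ?expR_ge0 ?Gamma_integral_lty.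
have mG : measurable_fun (`]0, +oo[%classic : set R)
    (fun t => (t `^ (n.+1%:R - 1) * expR (- t))%:E).
  apply/measurable_EFinP; apply: measurable_fun_halfline => t t0.
  apply: cvgM; first exact: continuous_powR.
  by apply: (@continuous_comp _ _ _ -%R expR); [exact: opp_continuous|exact: continuous_expR].
rewrite -ge0_integralZl_EFin ?expR_ge0//; last first.
  by move=> t _; rewrite lee_fin mulr_ge0 ?powR_ge0 ?expR_ge0.
apply: ge0_le_integral => //=.
- by move=> t; rewrite in_itv/= andbT => /(cubic_density_gt0 n)/ltW; rewrite lee_fin.
- by apply/measurable_EFinP; apply: measurable_fun_halfline => x _; exact: continuous_cubic_density.
- exact: measurable_funeM.
- move=> t; rewrite in_itv/= andbT => t0; rewrite -EFinM lee_fin mulrCA.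
  rewrite -natr1 addrK powR_mulrn ?(ltW t0)//.
  by rewrite ler_wpM2l ?exprn_ge0 ?expR_cube_le ?ltW.
Qed.

Let cvgy_cubic n : cubic_density n t @[t --> +oo] --> 0.
Proof.
(* The constant comes from [expR_cube_le] and from [powRD1_le_expR] with [m = n + 1]; the spare
   power of [t + 1] yields the majorant C/(t+1). *)
pose C : R := expR 1 * n.+1%:R `^ n.+1%:R.
have : C * (t + 1) `^ (- 1) @[t --> +oo] --> C * 0.
  by apply: cvgM; [exact: cvg_cst|exact: cvgy_powRD1N].
rewrite mulr0 => h; apply: (squeeze_cvgr _ (cvg_cst 0) h); near=> t.
have t0 : 0 < t by near: t; exact: nbhs_pinfty_gt.
have t1 : 0 < t + 1 by rewrite addr_gt0.
rewrite ltW ?cubic_density_gt0//=.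
apply: (@le_trans _ _ (t ^+ n * (expR 1 * expR (- t)))).
  by rewrite ler_wpM2l ?exprn_ge0 ?expR_cube_le ?ltW.
rewrite mulrCA /C -mulrA ler_wpM2l ?expR_ge0// powR_inv1 ?(ltW t1)// ler_pdivlMr//.
rewrite expRN mulrAC ler_pdivrMr ?expR_gt0//.
apply: le_trans (powRD1_le_expR _ t _ (ltW t0)); last by rewrite ler1n.
rewrite powR_mulrn ?(ltW t1)// exprSr ler_wpM2r ?(ltW t1)//.
by rewrite lerXn2r ?nnegrE ?lerDl ?(ltW t0) ?(ltW t1).
Unshelve. all: by end_near. Qed.

(** Integration by parts with primitive [cubic_density n.+1], which vanishes at both ends. *)
Lemma cubic_moment_rec n :
  (3%:E * cubic_moment n.+3 = n.+1%:R%:E * cubic_moment n)%E.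
Proof.
have scale k m : 0 <= k -> (k%:E * cubic_moment m =
    \int[mu]_(t in `]0%R, +oo[) (k * cubic_density m t)%:E)%E.
  move=> k0; under eq_integral do rewrite EFinM.
  rewrite ge0_integralZl_EFin//.
    by move=> v; rewrite /= in_itv/= andbT => /(cubic_density_gt0 m)/ltW; rewrite lee_fin.
  by apply/measurable_EFinP; apply: measurable_fun_halfline => x _; exact: continuous_cubic_density.
have ge0 k m t : 0 <= k -> 0 < t -> 0 <= k * cubic_density m t.
  by move=> k0 t0; rewrite mulr_ge0// ltW// cubic_density_gt0.
have cts k m t : 0 < t -> {for t, continuous (fun t => k * cubic_density m t)}.
  by move=> t0; apply: cvgM; [exact: cvg_cst|exact: continuous_cubic_density].
rewrite !scale//; apply/esym.
have := @integral_halfline_FTC _ (fun t => n.+1%:R * cubic_density n t)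
  (fun t => 3 * cubic_density n.+3 t) (cubic_density n.+1) 0 0.
rewrite subrr adde0; apply => //.
- by move=> t; exact: ge0.
- by move=> t; exact: ge0.
- by move=> t; exact: cts.
- by move=> t; exact: cts.
- move=> t _; apply: (is_derive_eq (is_derive_cubic n.+1 t)).
  by rewrite /cubic_density -mulrA.
- rewrite (_ : nbhs 0 = nbhs (cubic_density n.+1 0)); last by rewrite /cubic_density expr0n mul0r.
  by apply: cvg_at_right_filter; apply: continuous_cubic_density.
Qed.

(** Substitution of [s * t] with [s] the cube root of [l]. It evaluates the inner integral, with
    [l = v + 1], once the integrals defining the Kummer moments are exchanged. *)
Lemma cubic_moment_scale n l : 0 < l ->
  (\int[mu]_(t in `]0%R, +oo[) (t ^+ n * expR (- (l * t ^+ 3)))%:E =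
   (l `^ (- (n.+1%:R / 3)))%:E * cubic_moment n)%E.
Proof.
move=> l0; pose s := l `^ (3^-1).
have s0 : 0 < s by rewrite powR_gt0.
have s3 : s ^+ 3 = l.
  by rewrite -powR_mulrn ?(ltW s0)// -powRrM mulVf// powRr1// ltW.
have sE : l `^ (- (n.+1%:R / 3)) = (s ^+ n.+1)^-1.
  by rewrite powRN mulrC powRrM powR_mulrn// powR_ge0.
have dF : (fun t => s * t)^`()%classic = cst s.
  apply/funext => t; rewrite derive1E deriveZ//= derive_id.
  by rewrite -[_ *: _]/(_ * _) mulr1.
have := @increasing_ge0_integration_by_substitutiony _ (fun t => s * t) (cubic_density n) 0.
rewrite dF mulr0 -!integral_itv_obnd_cbnd; last 2 first.
- apply/measurable_EFinP; apply: measurable_fun_halfline => t _.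
  apply: cvgM; last exact: cvg_cst.
  apply: continuous_comp; last exact: continuous_cubic_density.
  exact: mulrl_continuous.
- by apply/measurable_EFinP; apply: measurable_fun_halfline => t _; exact: continuous_cubic_density.
rewrite -/(cubic_moment n) => ->; first last.
- by move=> t; rewrite in_itv/= andbT => /(cubic_density_gt0 n)/ltW.
- exact/continuous_subspaceT/continuous_cubic_density.
- exact: gt0_cvgMry.
- split; first by move=> t _; exact: derivableZ.
  by apply: cvg_at_right_filter; exact: mulrl_continuous.
- exact: is_cvg_cst.
- exact: is_cvg_cst.
- by move=> t _; exact: cvg_cst.
- by move=> x y _ _; rewrite ltr_pM2l.
rewrite -ge0_integralZl_EFin ?powR_ge0//; last 2 first.
- move=> t; rewrite /= in_itv/= andbT => t0.
  by rewrite lee_fin mulr_ge0 ?ltW// cubic_density_gt0// mulr_gt0.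
- apply/measurable_EFinP; apply: measurable_fun_halfline => t _.
  apply: cvgM; last exact: cvg_cst.
  apply: continuous_comp; last exact: continuous_cubic_density.
  exact: mulrl_continuous.
apply: eq_integral => t _; rewrite -EFinM; congr EFin.
rewrite sE -[(_ * cst _) t]/(cubic_density n (s * t) * s).
rewrite /cubic_density !exprMn s3 [s ^+ n.+1]exprSr; field.
by rewrite !lt0r_neq0// exprn_gt0.
Qed.

End CubicExponential.

(** * Moments of Kummer's function *)

Section TonelliOn.
Context {d1 d2 : measure_display} {T1 : measurableType d1}
  {T2 : measurableType d2} {R : realType}.
Variables (m1 : {sigma_finite_measure set T1 -> \bar R})
  (m2 : {sigma_finite_measure set T2 -> \bar R}).
Variables (D : set T1) (E : set T2) (h : T1 * T2 -> \bar R).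
Hypotheses (mD : measurable D) (mE : measurable E).
Hypothesis mh : measurable_fun (D `*` E) h.
Hypothesis h0 : forall x y, D x -> E y -> (0 <= h (x, y))%E.

(** Extending [h] by zero brings the whole-space Tonelli theorem to bear on the product of [D] and
    [E]. *)
Let f := h \_ (D `*` E).

Let mf : measurable_fun setT f.
Proof. exact/(measurable_restrictT h (measurableX mD mE)). Qed.

Let f0 z : (0 <= f z)%E.
Proof.
case: z => x y; rewrite /f patchE; case: ifPn => //.
by rewrite inE => -[/= Dx Ey]; exact: h0.
Qed.

Let fE1 : (fun x => \int[m2]_y f (x, y))%E = (fun x => \int[m2]_(y in E) h (x, y))%E \_ D.
Proof.
apply/funext => x; rewrite [RHS]patchE; case: ifPn => [|/negP]; rewrite inE => Dx.
  rewrite [RHS]integral_mkcond; apply: eq_integral => y _; rewrite /f !patchE.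
  by congr (if _ then _ else _); rewrite in_setX [x \in D]mem_set.
rewrite -[RHS](integral0 m2 setT); apply: eq_integral => y _.
by rewrite /f patchE memNset//; case.
Qed.

Let fE2 : (fun y => \int[m1]_x f (x, y))%E = (fun y => \int[m1]_(x in D) h (x, y))%E \_ E.
Proof.
apply/funext => y; rewrite [RHS]patchE; case: ifPn => [|/negP]; rewrite inE => Ey.
  rewrite [RHS]integral_mkcond; apply: eq_integral => x _; rewrite /f !patchE.
  by congr (if _ then _ else _); rewrite in_setX [y \in E]mem_set// andbT.
rewrite -[RHS](integral0 m1 setT); apply: eq_integral => x _.
by rewrite /f patchE memNset//; case.
Qed.

Lemma tonelli_on :
  (\int[m1]_(x in D) \int[m2]_(y in E) h (x, y) =
   \int[m2]_(y in E) \int[m1]_(x in D) h (x, y))%E.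
Proof.
rewrite integral_mkcond -fE1 [RHS]integral_mkcond -fE2.
exact: fubini_tonelli.
Qed.

Lemma measurable_fun_tonelli_on :
  measurable_fun D (fun x => \int[m2]_(y in E) h (x, y))%E.
Proof.
apply/(measurable_restrictT _ mD); rewrite -fE1.
exact: (measurable_fun_fubini_tonelli_F (m2 := m2) f).
Qed.

End TonelliOn.

Section FineIntegral.
Context {d : measure_display} {T : measurableType d} {R : realType}.
Variables (mu : {measure set T -> \bar R}) (D : set T) (f : T -> \bar R).
Hypotheses (mD : measurable D) (intf : mu.-integrable D f).

(** An integrable function is finite almost everywhere, so [fine] alters it only on a null set. *)
Lemma ae_eq_fine : ae_eq mu D (EFin \o (fine \o f)) f.
Proof.
by apply: filterS (integrable_ae mD intf) => x fx /fx /= ?; rewrite fineK.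
Qed.

Lemma measurable_fine_integrable : measurable_fun D (fine \o f).
Proof.
by apply: measurableT_comp => //; exact: measurable_int intf.
Qed.

Lemma integrable_fine : mu.-integrable D (EFin \o (fine \o f)).
Proof.
apply: le_integrable intf => //.
  by apply/measurable_EFinP; exact: measurable_fine_integrable.
by move=> x _ /=; case: (f x) => [r||] //=; rewrite normr0 leey.
Qed.

Lemma Rintegral_fine : (\int[mu]_(x in D) fine (f x))%R = fine (\int[mu]_(x in D) f x)%E.
Proof.
congr fine; apply: ae_eq_integral => //.
- by apply/measurable_EFinP; exact: measurable_fine_integrable.
- exact: measurable_int intf.
- exact: ae_eq_fine.
Qed.

End FineIntegral.

Section KummerMoments.
Context {R : realType}.
Notation mu := (@lebesgue_measure R).
Variables (a b : R) (n : nat).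
(** Chosen so that -(a+c) = (b-a-1) - (n+1)/3: the integral over [t] contributes the power -(n+1)/3
    of [v + 1]. *)
Let c := n.+1%:R / 3 + 1 - b.
Hypotheses (a0 : 0 < a) (c0 : 0 < c).

(** The integrand of the double integral, [z.1] being the moment variable and [z.2] the Kummer
    variable; the exponentials of -t^3 and -v t^3 are merged. *)
Let h (z : R * R) : R :=
  z.2 `^ (a - 1) * (z.2 + 1) `^ (b - a - 1) *
  (z.1 ^+ n * expR (- ((z.2 + 1) * z.1 ^+ 3))).

Let h_ge0 t v : 0 < t -> 0 <= h (t, v).
Proof.
by move=> t0; rewrite /h !mulr_ge0 ?powR_ge0 ?exprn_ge0 ?expR_ge0 ?(ltW t0).
Qed.

Let measurable_h : measurable_fun setT (EFin \o h).
Proof.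
apply/measurable_EFinP; apply: measurable_funM.
  apply: measurable_funM.
    by apply: (measurableT_comp (measurable_powR _)).
  apply: (measurableT_comp (measurable_powR _)).
  by apply: measurable_funD.
apply: measurable_funM; first exact: measurable_funX.
apply: measurableT_comp => //; apply: measurable_funN.
apply: measurable_funM; first exact: measurable_funD.
exact: measurable_funX.
Qed.

Let H t : \bar R := (\int[mu]_(v in `]0%R, +oo[) (h (t, v))%:E)%E.

Let integral_H : (\int[mu]_(t in `]0%R, +oo[) H t = cubic_moment n * beta_integral a c)%E.
Proof.
rewrite /H (@tonelli_on _ _ _ _ _ mu mu _ _ (EFin \o h))//; last 2 first.
- exact: measurable_funTS.
- by move=> t v /=; rewrite in_itv/= andbT lee_fin => t0 _; exact: h_ge0.
transitivity (\int[mu]_(v in `]0%R, +oo[) (cubic_moment n * (beta_density a c v)%:E))%E.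
  apply: eq_integral => v; rewrite inE/= in_itv/= andbT => v0.
  have v1 : 0 < v + 1 by rewrite addr_gt0.
  under eq_integral do rewrite /h/= EFinM.
  rewrite ge0_integralZl_EFin//; last 3 first.
  - by move=> t; rewrite /= in_itv/= andbT => t0; rewrite lee_fin mulr_ge0 ?expR_ge0 ?exprn_ge0 ?(ltW t0).
  - apply/measurable_EFinP; apply: measurable_funM; first exact: measurable_funX.
    apply: measurableT_comp => //; apply: measurable_funN.
    by apply: measurable_funM => //; exact: measurable_funX.
  - by rewrite mulr_ge0 ?powR_ge0.
  rewrite cubic_moment_scale// muleA -EFinM muleC; congr (_ * _%:E)%E.
  rewrite /beta_density -mulrA -powRD; last by rewrite lt0r_neq0 ?implybT.
  by congr (_ * _ `^ _); rewrite /c; ring.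
rewrite ge0_integralZl//.
- by apply/measurable_EFinP; apply: measurable_fun_halfline => x; exact: continuous_beta_density.
- by move=> v; rewrite /= in_itv/= andbT lee_fin => /(beta_density_gt0 a c)/ltW.
- exact/ltW/cubic_moment_gt0.
Qed.

Let integrable_H : mu.-integrable `]0%R, +oo[ H.
Proof.
apply/integrableP; split.
  apply: (@measurable_fun_tonelli_on _ _ (measurableTypeR R) _ _ mu _ _ (EFin \o h)) => //.
  - exact: measurable_funTS.
  - by move=> t v /=; rewrite in_itv/= andbT lee_fin => t0 _; exact: h_ge0.
under eq_integral => t.
  rewrite inE/= in_itv/= andbT => t0.
  rewrite gee0_abs; first over.
  by apply: integral_ge0 => v _; rewrite lee_fin h_ge0.
rewrite integral_H lte_mul_pinfty ?beta_integral_lty//.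
  exact/ltW/cubic_moment_gt0.
by rewrite ge0_fin_numE ?cubic_moment_lty// ltW// cubic_moment_gt0.
Qed.

Let kummer_H (t : R) : 0 < t ->
  cubic_density n t * kummerU a b (t ^+ 3) = (Gamma a)^-1 * fine (H t).
Proof.
move=> t0; rewrite /kummerU mulrCA; congr (_ * _).
have k0 := cubic_density_gt0 n t t0.
have -> : H t = ((cubic_density n t)%:E * \int[mu]_(v in `]0%R, +oo[)
    (v `^ (a - 1) * (v + 1) `^ (b - a - 1) * expR (- (v * t ^+ 3)))%:E)%E.
  rewrite -ge0_integralZl_EFin ?(ltW k0)//; last 2 first.
  - by move=> v _; rewrite lee_fin !mulr_ge0 ?powR_ge0 ?expR_ge0.
  - apply/measurable_EFinP; apply: measurable_fun_halfline => v v0.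
    apply: cvgM; first apply: cvgM.
    + exact: continuous_powR.
    + exact/continuous_powRD1/ltW.
    + have cN : {for v, continuous (fun w : R => - (w * t ^+ 3))}.
        by apply: cvgN; exact: mulrr_continuous.
      exact: continuous_comp cN (@continuous_expR R _).
  apply: eq_integral => v _; rewrite -EFinM; congr EFin.
  rewrite /h/cubic_density/= mulrDl mul1r opprD expRD; ring.
(* [fine] sends an infinite integral to 0, which commutes with the factor. *)
rewrite /Rintegral; case: (\int[mu]_(v in _) _)%E => [r||] /=.
- by [].
- by rewrite mulr0 gt0_muley ?lte_fin.
- by rewrite mulr0 gt0_muleNy ?lte_fin.
Qed.

Lemma integrable_kummer :
  mu.-integrable `]0%R, +oo[ (fun t => (cubic_density n t * kummerU a b (t ^+ 3))%:E).
Proof.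
apply: (@eq_integrable _ (measurableTypeR R) _ _ _ _ (fun t => (Gamma a)^-1%:E * (fine (H t))%:E)%E) => //.
  by move=> t; rewrite inE/= in_itv/= andbT => /kummer_H ->.
by apply: integrableZl => //; exact: integrable_fine.
Qed.

Lemma Rintegral_kummer :
  \int[mu]_(t in `]0, +oo[) (cubic_density n t * kummerU a b (t ^+ 3)) =
  (Gamma a)^-1 * (fine (cubic_moment n) * fine (beta_integral a c)).
Proof.
transitivity (\int[mu]_(t in `]0, +oo[) ((Gamma a)^-1 * fine (H t))).
  by apply: eq_Rintegral => t; rewrite inE/= in_itv/= andbT => /kummer_H.
rewrite RintegralZl//; last exact: integrable_fine.
rewrite Rintegral_fine// integral_H fineM//.
- by rewrite ge0_fin_numE ?cubic_moment_lty// ltW// cubic_moment_gt0.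
- by rewrite ge0_fin_numE ?beta_integral_lty// ltW// beta_integral_gt0.
Qed.

End KummerMoments.

(** * Moment recurrences for the two weights *)

Section Moments.
Context {R : realType}.
Notation mu := (@lebesgue_measure R).
Implicit Types (U : R -> R) (n : nat).

Definition moment U n : R := \int[mu]_(t in `]0, +oo[) (t ^+ n * U t).

Definition moments_converge U : Prop :=
  forall n, mu.-integrable `]0, +oo[ (fun t => (t ^+ n * U t)%:E).

(** The moment is a constant times K(n+p) J(c). Raising [n] by 3 raises [c] by exactly 1, so the
    recurrences of K and J apply together and multiply. *)
Lemma moment_scaled_kummer U (k a b : R) p : 0 < k -> 0 < a ->
    (forall t, U t = k * (cubic_density p t * kummerU a b (t ^+ 3))) ->
    (forall n, 0 < (n + p).+1%:R / 3 + 1 - b) ->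
  [/\ moments_converge U, forall n, 0 < moment U n &
      forall n, 3 * (a + ((n + p).+1%:R / 3 + 1 - b)) * moment U (n + 3) =
                (n + p).+1%:R * ((n + p).+1%:R / 3 + 1 - b) * moment U n].
Proof.
move=> k0 a0 UE c0.
have UnE n t : t ^+ n * U t = k * (cubic_density (n + p) t * kummerU a b (t ^+ 3)).
  by rewrite UE /cubic_density exprD; ring.
have int n := integrable_kummer a b (n + p) a0 (c0 n).
pose c n : R := (n + p).+1%:R / 3 + 1 - b.
pose K n : R := fine (cubic_moment n); pose J n : R := fine (beta_integral a (c n)).
have MJ n : moment U n = k * ((Gamma a)^-1 * (K (n + p)%N * J n)).
  rewrite -(Rintegral_kummer a b (n + p) a0 (c0 n)) -RintegralZl//; last exact: int.
  by apply: eq_Rintegral => t _; rewrite UnE.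
have K0 n : 0 < K n by rewrite fine_gt0// cubic_moment_gt0 cubic_moment_lty.
have J0 n : 0 < J n by rewrite fine_gt0// beta_integral_gt0 beta_integral_lty//; exact: c0.
have KE n : cubic_moment n = (K n)%:E.
  by rewrite fineK// ge0_fin_numE ?cubic_moment_lty// ltW// cubic_moment_gt0.
have JE n : beta_integral a (c n) = (J n)%:E.
  by rewrite fineK// ge0_fin_numE ?beta_integral_lty ?c0// ltW// beta_integral_gt0.
split=> [n|n|n].
- apply: (@eq_integrable _ (measurableTypeR R) _ _ _ _
    (fun t => k%:E * (cubic_density (n + p) t * kummerU a b (t ^+ 3))%:E)%E) => //.
    by move=> t _; rewrite -EFinM UnE.
  exact: integrableZl (int n).
- by rewrite MJ !mulr_gt0 ?invr_gt0 ?Gamma_gt0.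
- have := cubic_moment_rec (R := R) (n + p); rewrite !KE -!EFinM => -[KK].
  have := beta_integral_rec a (c n) a0 (c0 n).
  rewrite (_ : c n + 1 = c (n + 3)%N); last first.
    by rewrite /c -!natr1 !natrD; field.
  rewrite !JE -!EFinM => -[JJ].
  rewrite !MJ addnAC addn3 -/(c n).
  transitivity (k * ((Gamma a)^-1 * ((3 * K (n + p).+3) * ((a + c n) * J (n + 3)%N)))).
    by ring.
  by rewrite KK -JJ; ring.
Qed.

(** Here [p = 0] and [b = 2/3], whence c = (n+2)/3 and a + c = (rho+n+3)/3. *)
Lemma calU0_moments (rho : R) : 0 < rho ->
  [/\ moments_converge (calU0 rho), forall n, 0 < moment (calU0 rho) n &
      forall n, 3 * (rho + n.+3%:R) * moment (calU0 rho) (n + 3) =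
                n.+1%:R * n.+2%:R * moment (calU0 rho) n].
Proof.
move=> rho0.
have g a : 0 < a -> 0 < Gamma a :> R := @Gamma_gt0 R a.
have [|||n|h1 h2 h3] := @moment_scaled_kummer (calU0 rho)
  (3 * Gamma ((rho + 3) / 3) / (Gamma (1 / 3) * Gamma (2 / 3))) ((rho + 1) / 3) (2 / 3) 0.
- by rewrite !mulr_gt0 ?invr_gt0 ?mulr_gt0 ?g//; lra.
- by lra.
- by move=> t; rewrite /calU0/cubic_density expr0 (mul1r (expR _)) !mulrA.
- have := ler0n R n; rewrite addn0 -natr1; lra.
split=> // n; have := h3 n; rewrite addn0 => h.
have -> : 3 * (rho + n.+3%:R) =
  3 * (3 * ((rho + 1) / 3 + (n.+1%:R / 3 + 1 - 2 / 3))) :> R.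
  by rewrite -[n.+3]addn2 -[n.+1]addn1 !natrD; field.
by rewrite -mulrA h -[n.+2]addn2 -[n.+1]addn1 !natrD; field.
Qed.

(** Here [p = 2] and [b = 5/3], whence c = (n+1)/3 and a + c = (rho+n+2)/3. *)
Lemma calU1_moments (rho : R) : 0 < rho ->
  [/\ moments_converge (calU1 rho), forall n, 0 < moment (calU1 rho) n &
      forall n, 3 * (rho + n.+2%:R) * moment (calU1 rho) (n + 3) =
                n.+3%:R * n.+1%:R * moment (calU1 rho) n].
Proof.
move=> rho0.
have g a : 0 < a -> 0 < Gamma a :> R := @Gamma_gt0 R a.
have [|||n|h1 h2 h3] := @moment_scaled_kummer (calU1 rho)
  (9 * Gamma ((rho + 3) / 3) / (Gamma (1 / 3) * Gamma (2 / 3))) ((rho + 1) / 3) (5 / 3) 2.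
- by rewrite !mulr_gt0 ?invr_gt0 ?mulr_gt0 ?g//; lra.
- by lra.
- by move=> t; rewrite /calU1/cubic_density !mulrA.
- have := ler0n R n; rewrite addn2 -[n.+3]addn3 natrD; lra.
split=> // n; have := h3 n; rewrite addn2 => h.
have -> : 3 * (rho + n.+2%:R) =
  3 * (3 * ((rho + 1) / 3 + (n.+3%:R / 3 + 1 - 5 / 3))) :> R.
  by rewrite -[n.+3]addn3 -[n.+2]addn2 !natrD; field.
by rewrite -mulrA h -[n.+3]addn3 -[n.+1]addn1 !natrD; field.
Qed.

End Moments.

(** * The functionals in terms of moments *)

Section RayMoments.
Context {R : realType}.
Local Open Scope complex_scope.
Notation mu := (@lebesgue_measure R).
Implicit Types (U : R -> R) (zeta c : R[i]) (f : {poly R[i]}).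

Lemma Re_mulr_real (z : R[i]) (r : R) : complex.Re (z * r%:C) = complex.Re z * r.
Proof. by case: z => x y /=; rewrite mulr0 subr0. Qed.

Lemma Im_mulr_real (z : R[i]) (r : R) : complex.Im (z * r%:C) = complex.Im z * r.
Proof. by case: z => x y /=; rewrite mulr0 add0r. Qed.

Lemma integral_moment_sum U (x : nat -> R) N : moments_converge U ->
  mu.-integrable `]0, +oo[ (fun t => (\sum_(m < N) x m * (t ^+ m * U t))%:E) /\
  \int[mu]_(t in `]0, +oo[) (\sum_(m < N) x m * (t ^+ m * U t)) =
  \sum_(m < N) x m * moment U m.
Proof.
move=> iU; elim: N => [|N [IHi IH]].
  split; last by rewrite big_ord0 /Rintegral integral0_eq// => t _; rewrite big_ord0.
  apply: (@eq_integrable _ (measurableTypeR R) _ _ _ _ (cst 0%E)) => //.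
    by move=> t _; rewrite big_ord0.
  exact: integrable0.
have iN : mu.-integrable `]0, +oo[ (fun t => (x N * (t ^+ N * U t))%:E).
  apply: (@eq_integrable _ (measurableTypeR R) _ _ _ _ (fun t => (x N)%:E * (t ^+ N * U t)%:E)%E) => //.
  exact: integrableZl (iU N).
split.
  apply: (@eq_integrable _ (measurableTypeR R) _ _ _ _
    (fun t => (\sum_(m < N) x m * (t ^+ m * U t))%:E + (x N * (t ^+ N * U t))%:E)%E) => //.
    by move=> t _; rewrite big_ord_recr.
  exact: integrableD.
under eq_Rintegral do rewrite big_ord_recr.
rewrite /= RintegralD// IH big_ord_recr/= RintegralZl//; exact: iU.
Qed.

(** The relation [c * zeta = 1] makes the argument of [U] equal to [t], so each ray sees the same
    real moments. The extra power of [zeta] is the factor in dx = zeta dt. *)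
Lemma ray_pullbackE U zeta c f (t : R) : c * zeta = 1 ->
  ray_pullback zeta (weighted U c f) t =
  \sum_(m < size f) (f`_m * zeta ^+ m.+1) * (t ^+ m * U t)%:C.
Proof.
move=> cz; rewrite /ray_pullback /weighted mulrCA cz mulr1 /=.
rewrite horner_coef !mulr_suml; apply: eq_bigr => m _.
by rewrite exprMn rmorphM rmorphXn/= exprS; ring.
Qed.

Lemma ray_moments U zeta c f : moments_converge U -> c * zeta = 1 ->
  ray_integrable zeta (weighted U c f) /\
  ray_integral zeta (weighted U c f) =
  \sum_(m < size f) (f`_m * zeta ^+ m.+1) * (moment U m)%:C.
Proof.
move=> iU cz; pose z m := f`_m * zeta ^+ m.+1.
have ReE t : complex.Re (ray_pullback zeta (weighted U c f) t) =
    \sum_(m < size f) complex.Re (z m) * (t ^+ m * U t).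
  by rewrite ray_pullbackE// raddf_sum; apply: eq_bigr => m _; rewrite /= Re_mulr_real.
have ImE t : complex.Im (ray_pullback zeta (weighted U c f) t) =
    \sum_(m < size f) complex.Im (z m) * (t ^+ m * U t).
  by rewrite ray_pullbackE// raddf_sum; apply: eq_bigr => m _; rewrite /= Im_mulr_real.
have [iRe eRe] := integral_moment_sum U (fun m => complex.Re (z m)) (size f) iU.
have [iIm eIm] := integral_moment_sum U (fun m => complex.Im (z m)) (size f) iU.
split.
  split.
    by apply: (@eq_integrable _ (measurableTypeR R) _ _ _ _ _ _ _ iRe) => // t _; rewrite ReE.
  by apply: (@eq_integrable _ (measurableTypeR R) _ _ _ _ _ _ _ iIm) => // t _; rewrite ImE.
rewrite /ray_integral.
under eq_Rintegral do rewrite ReE.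
under [X in _ +i* X]eq_Rintegral do rewrite ImE.
rewrite eRe eIm; apply/eqP; rewrite eq_complex/= !raddf_sum/=; apply/andP.
by split; apply/eqP; apply: eq_bigr => m _; rewrite ?Re_mulr_real ?Im_mulr_real.
Qed.

Lemma omega_root : omega ^+ 3 = 1 :> R[i] /\ 1 + omega + omega ^+ 2 = 0 :> R[i].
Proof.
pose th : R := 2 * pi / 3.
have p0 := pi_gt0 R.
have s0 : 0 < sin th by apply: sin_gt0_pi; rewrite /th; lra.
have w3 : omega ^+ 3 = 1 :> R[i].
  have th3 : th + th + th = pi *+ 2 by rewrite /th mulr2n; field.
  have c := cosD (th + th) th; have s := sinD (th + th) th.
  rewrite th3 cos2pi cosD sinD in c; rewrite th3 sin2pi cosD sinD in s.
  rewrite !exprS expr0 mulr1 /omega -/th; apply/eqP; rewrite eq_complex/=.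
  by rewrite c s; apply/andP; split; apply/eqP; ring.
split=> //.
(* The imaginary part sin(2 pi/3) is positive, so [omega - 1] cancels from omega^3 - 1 = 0. *)
have w1 : omega - 1 != 0 :> R[i].
  rewrite /omega -/th; apply/eqP => /(congr1 (@complex.Im R))/= /eqP.
  by rewrite oppr0 addr0 gt_eqF.
apply: (mulfI w1); rewrite mulr0.
by transitivity (omega ^+ 3 - 1 : R[i]); [ring|rewrite w3 subrr].
Qed.

(** The averaging filter over the cube roots of unity, which picks out the exponents divisible by
    3. *)
Lemma omega_sum j :
  3^-1 * (1 + omega ^+ j + omega ^+ (2 * j)) = (3 %| j)%N%:R :> R[i].
Proof.
have [w3 w0] := omega_root.
have wj : omega ^+ j = omega ^+ (j %% 3) :> R[i].
  by rewrite {1}(divn_eq j 3) exprD mulnC exprM w3 expr1n mul1r.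
rewrite mulnC exprM wj /dvdn; have := ltn_pmod j (isT : (0 < 3)%N).
case: (j %% 3)%N => [|[|[|//]]] _ /=.
- by rewrite expr0 expr1n; field.
- by rewrite expr1 w0 mulr0.
- by rewrite -exprM (exprD _ 3 1) w3 mul1r expr1 addrAC w0 mulr0.
Qed.

(** On x^m the two rotated rays carry omega^(m+2k) and omega^(2m+3-2k). The latter equals
    omega^(2(m+2k)) because omega^3 = 1, so [omega_sum] applies with [j = m + 2k] and keeps m
    congruent to k modulo 3. *)
Lemma functional_momentsE U f (k : nat) : moments_converge U -> (k <= 1)%N ->
  functional_converges U f /\
  functional k U f =
  \sum_(m < size f) f`_m * (((3 %| m + 2 * k)%N%:R : R) * moment U m)%:C.
Proof.
move=> iU k1; have [w3 w0] := omega_root.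
have w0' : omega != 0 :> R[i].
  by apply/eqP => e; move: w3; rewrite e expr0n => /esym/eqP; rewrite oner_eq0.
have wV : omega^-1 = omega ^+ 2 :> R[i].
  by apply: (mulfI w0'); rewrite mulfV// -exprS w3.
have [i0 e0] := ray_moments U 1 1 f iU (mulr1 1).
have [|i1 e1] := ray_moments U omega (omega ^+ 2) f iU; first by rewrite -exprSr.
have [|i2 e2] := ray_moments U (omega ^+ 2) omega f iU; first by rewrite -exprS.
split; first by split.
rewrite /functional e0 e1 e2 !mulr_sumr -!big_split/= mulr_sumr.
apply: eq_bigr => m _; rewrite rmorphM rmorph_nat -omega_sum expr1n.
case: k k1 => [|[|//]] _.
  rewrite (_ : 2 * 0%:Z - 1 = -1)// (_ : 1 - 2 * 0%:Z = 1)// exprN1 expr1z wV.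
  rewrite muln0 addn0 exprAC !exprS (mulnC 2) exprM.
  by move: (3^-1) (omega ^+ m) w3 => i3 W; set w := omega => w3; ring: w3.
rewrite (_ : 2 * 1%:Z - 1 = 1)// (_ : 1 - 2 * 1%:Z = -1)// exprN1 expr1z wV.
rewrite muln1 exprAC !exprS (mulnC 2) exprM exprD.
by move: (3^-1) (omega ^+ m) w3 => i3 W; set w := omega => w3; ring: w3.
Qed.

End RayMoments.

(** * The coefficients of the polynomials *)

Section RisingFactorial.
Context {R : realType}.
Implicit Types (x y : R) (n i j k : nat).

Definition rising x n : R := \prod_(l < n) (x + l%:R).
Definition falling x n : R := \prod_(l < n) (x - l%:R).

Lemma rising0 x : rising x 0 = 1. Proof. exact: big_ord0. Qed.
Lemma falling0 x : falling x 0 = 1. Proof. exact: big_ord0. Qed.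

Lemma risingS x n : rising x n.+1 = rising x n * (x + n%:R).
Proof. exact: big_ord_recr. Qed.

Lemma risingSl x n : rising x n.+1 = x * rising (x + 1) n.
Proof.
rewrite /rising big_ord_recl addr0; congr (_ * _); apply: eq_bigr => l _.
by rewrite /= /bump add1n -natr1 addrAC addrA.
Qed.

Lemma fallingS x n : falling x n.+1 = falling x n * (x - n%:R).
Proof. exact: big_ord_recr. Qed.

Lemma fallingSl x n : falling x n.+1 = x * falling (x - 1) n.
Proof.
rewrite /falling big_ord_recl subr0; congr (_ * _); apply: eq_bigr => l _.
by rewrite /= /bump add1n -natr1 opprD addrAC addrA.
Qed.

Lemma risingD x n k : rising x (n + k) = rising x n * rising (x + n%:R) k.
Proof.
elim: k => [|k IH]; first by rewrite addn0 rising0 mulr1.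
by rewrite addnS !risingS IH natrD -!mulrA addrA.
Qed.

Lemma falling_rising x n : falling (x + n%:R) n = rising (x + 1) n.
Proof.
elim: n => [|n IH]; first by rewrite falling0 rising0.
by rewrite fallingSl risingS -natr1 addrA addrK IH mulrC addrAC.
Qed.

Lemma rising_gt0 x n : 0 < x -> 0 < rising x n.
Proof. by move=> x0; apply: prodr_gt0 => l _; rewrite ltr_wpDr. Qed.

(** Up to sign, the n-th finite difference of [f] at 0. *)
Let alternating (f : nat -> R) n := \sum_(j < n.+1) (-1) ^+ j * 'C(n, j)%:R * f j.

Let alternatingS f n :
  alternating f n.+1 = alternating f n - alternating (f \o succn) n.
Proof.
rewrite /alternating big_ord_recl bin0 /=.
rewrite (eq_bigr (fun j : 'I_n.+1 => (-1) ^+ j.+1 * 'C(n, j.+1)%:R * f j.+1 +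
    (-1) ^+ j.+1 * 'C(n, j)%:R * f j.+1)); last first.
  by move=> j _; rewrite /bump add1n binS natrD mulrDr mulrDl.
rewrite big_split/= addrA; congr (_ + _).
  rewrite [RHS]big_ord_recl bin0; congr (_ + _).
  rewrite big_ord_recr/= bin_small// mulr0 mul0r addr0.
  by apply: eq_bigr => j _; rewrite /bump add1n.
by rewrite -sumrN; apply: eq_bigr => j _; rewrite exprS; ring.
Qed.

(** A rising factorial of length [i] is a polynomial of degree [i] in [j], and each difference
    lowers the degree by one. *)
Lemma alternating_sum_rising n i x : (i < n)%N ->
  \sum_(j < n.+1) (-1) ^+ j * 'C(n, j)%:R * rising (x + j%:R) i = 0.
Proof.
elim: n i x => [//|n IH] [|i] x; rewrite ltnS => ilt.
  have := alternatingS (fun=> 1) n; rewrite subrr => E; rewrite -[RHS]E.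
  by apply: eq_bigr => j _; rewrite rising0.
have := alternatingS (fun j => rising (x + j%:R) i.+1) n; rewrite /alternating => ->.
(* With y = x + j, splitting off the end factors gives rising y (i+1) - rising (y+1) (i+1) = -(i+1)
   rising (y+1) i. *)
transitivity (- i.+1%:R * \sum_(j < n.+1) (-1) ^+ j * 'C(n, j)%:R * rising (x + 1 + j%:R) i).
  rewrite -sumrB mulr_sumr; apply: eq_bigr => j _ /=.
  rewrite risingSl (_ : x + 1 + j%:R = x + j%:R + 1); last ring.
  rewrite (_ : x + j.+1%:R = x + j%:R + 1) ?risingS -?natr1 ?addrA//; ring.
by rewrite IH// mulr0.
Qed.

End RisingFactorial.

Section Coefficients.
Context {R : realType}.
Variables (rho : R) (rho_gt0 : 0 < rho) (gamma : nat -> R).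
Hypothesis gamma_even : forall n : nat, (1 <= n)%N ->
  gamma (2 * n)%N = (2 * n%:R * (2 * n%:R + 1)) / (3 * (3 * n%:R + rho)).
Hypothesis gamma_odd : forall n : nat,
  gamma (2 * n + 1)%N = (2 * (n%:R + 1) * (2 * n%:R + 1) * (n%:R + rho)) /
    (3 * (3 * n%:R + rho) * (3 * n%:R + rho + 3)).
Implicit Types (m n k N : nat).

Lemma gamma_gt0 n : (1 <= n)%N -> 0 < gamma n.
Proof.
move=> n1.
have [q nE] : exists q, n = (2 * q + 1)%N \/ n = (2 * q.+1)%N.
  by exists n.-1./2; case: (boolP (odd n)); lia.
have q0 := ler0n R q; have r0 := rho_gt0.
 case: nE => ->.
  by rewrite gamma_odd; apply: divr_gt0; rewrite !mulr_gt0//; lra.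
by rewrite gamma_even// -natr1; apply: divr_gt0; rewrite !mulr_gt0//; lra.
Qed.

(** The number T of the explicit solution. Truncated subtraction makes it [rho / 3] at [N = 0],
    where only the empty falling product occurs. *)
Definition falling_start N : R := rho / 3 + (N.-1./2)%:R.

(* The coefficient of x^m in P_(m+3k). *)
Definition pcoef m k : R :=
  (-1) ^+ k * (m + 3 * k)`!%:R /
  (m`!%:R * k`!%:R * 27 ^+ k * falling (falling_start (m + 3 * k)) k).

Lemma pcoef0 m : pcoef m 0 = 1.
Proof.
by rewrite /pcoef muln0 addn0 expr0 falling0 fact0 expr0 !mulr1 mul1r divff//.
Qed.

(** Every [l < k] is at most the integer part of (m+3k-1)/2, so each factor is at least
    [rho / 3]. *)
Lemma falling_start_gt0 m k : 0 < falling (falling_start (m + 3 * k)) k.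
Proof.
have r0 := rho_gt0; apply: prodr_gt0 => -[l /= lk] _.
rewrite /falling_start -addrA ltr_pwDl//; first by lra.
rewrite subr_ge0 ler_nat; lia.
Qed.

(** The recurrence for P read at x^m. Each term is a rational multiple of [pcoef m k], and the
    resulting identity is checked for each parity of [m + 3k]. *)
Lemma pcoef_rec m k :
  pcoef m k.+1 = (if m is m'.+1 then pcoef m' k.+1 else 0)
     - gamma (m + 3 * k).+1 * pcoef m k.
Proof.
set N := (m + 3 * k).+2; have r0 := rho_gt0.
have fS n : n.+1`!%:R = n.+1%:R * n`!%:R :> R by rewrite factS natrM.
have f0 n : n`!%:R != 0 :> R by rewrite pnatr_eq0 -lt0n fact_gt0.
have [T0 TE] : 0 < falling_start N /\ falling (falling_start N) k.+1 =
    falling_start N * falling (falling_start (m + 3 * k)) k.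
  split; first by rewrite /falling_start ltr_pwDl//; lra.
  (* Raising the index by 2 raises the start by 1. The case [k = 0] is separate, since at index 0
     the truncated predecessor breaks this shift. *)
  rewrite fallingSl; congr (_ * _); case: k @N => [|k] N; first by rewrite !falling0.
  congr falling; rewrite /falling_start /N !mulnS.
  rewrite (_ : (m + (3 + 3 * k)).+2.-1./2 = ((m + (3 + 3 * k)).-1./2).+1) -?natr1; last lia.
  ring.
have F0 := lt0r_neq0 (falling_start_gt0 m k).
pose A := (-1) ^+ k * (m + 3 * k)`!%:R /
  (m`!%:R * k`!%:R * 27 ^+ k * falling (falling_start (m + 3 * k)) k).
have e27 : (27 : R) ^+ k != 0 by rewrite expf_neq0.
have k1 : k.+1%:R != 0 :> R by rewrite pnatr_eq0.
(* The factor [m%:R] lets one formula cover both branches. *)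
have m1E : (if m is m'.+1 then pcoef m' k.+1 else 0) =
    - A * (N%:R * N.-1%:R * m%:R / (27 * k.+1%:R * falling_start N)).
  case: m @N T0 TE F0 @A => [|m'] N T0 TE F0 A; first by rewrite mulr0 mul0r mulr0.
  rewrite /pcoef (_ : (m' + 3 * k.+1)%N = N); last by rewrite /N; lia.
  rewrite TE /A (fS (m'.+1 + 3 * k).+1) (fS (m'.+1 + 3 * k)%N) (fS m') (fS k) !exprS -/N /=.
  by field; rewrite !nat1r !f0 F0 e27 lt0r_neq0// !pnatr_eq0.
rewrite m1E [pcoef m k]/pcoef -/A /pcoef (_ : (m + 3 * k.+1)%N = N.+1); last by rewrite /N; lia.
rewrite /N fS fS fS fS exprS exprS /A; clear m1E; clear A; set e := 27 ^+ k in e27 *.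
set p := (m + 3 * k)%N in N T0 TE F0 *.
have pE : p%:R = m%:R + 3 * k%:R :> R by rewrite /p natrD natrM.
have [q pq] : exists q, p = (2 * q).+1 \/ p = (2 * q)%N.
  by exists p./2; case: (boolP (odd p)); lia.
(* For odd [p] the start is the same at [N] and [N.+1]; for even [p] it grows by 1. *)
have q0 := ler0n R q; case: pq => pq.
  have pR : p%:R = 2 * q%:R + 1 :> R by rewrite pq -natr1 natrM.
  have topE : falling_start N = rho / 3 + q%:R + 1.
    by rewrite /falling_start (_ : N.-1./2 = q.+1) -?natr1 ?addrA//; rewrite /N; lia.
  have gE : gamma p.+1 = 2 * (q%:R + 1) * (2 * (q%:R + 1) + 1) / (3 * (3 * (q%:R + 1) + rho)).
    by rewrite (_ : p.+1 = 2 * q.+1)%N ?gamma_even -?natr1//; lia.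
  have mE : m%:R = 2 * q%:R + 1 - 3 * k%:R :> R by rewrite -pR pE; ring.
  rewrite (_ : falling_start N.+1 = falling_start N); last first.
    by rewrite /falling_start; congr (_ + _%:R); rewrite /N; lia.
  rewrite TE topE gE /= -!natr1 pR mE.
  by field; rewrite F0 e27 !f0 [k%:R + 1]natr1 k1 lt0r_neq0//; lra.
have pR : p%:R = 2 * q%:R :> R by rewrite pq natrM.
have topE : falling_start N = rho / 3 + q%:R.
  by rewrite /falling_start (_ : N.-1./2 = q)//; rewrite /N; lia.
have gE : gamma p.+1 = (2 * (q%:R + 1) * (2 * q%:R + 1) * (q%:R + rho)) /
    (3 * (3 * q%:R + rho) * (3 * q%:R + rho + 3)).
  by rewrite -gamma_odd pq addn1.
have mE : m%:R = 2 * q%:R - 3 * k%:R :> R by rewrite -pR pE; ring.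
have kq : k%:R <= q%:R :> R by rewrite ler_nat; lia.
have Tk : falling_start N - k%:R != 0 by rewrite lt0r_neq0// topE; lra.
(* With T the start at [N], the product from T + 1 gains the top factor T + 1 and loses the bottom
   factor T - k, which is nonzero as k <= q. *)
have FE : falling (falling_start N.+1) k.+1 = (falling_start N + 1) *
    (falling_start N * falling (falling_start p) k / (falling_start N - k%:R)).
  rewrite (_ : falling_start N.+1 = falling_start N + 1); last first.
    by rewrite topE /falling_start (_ : N.+1.-1./2 = q.+1) -?natr1 ?addrA//; rewrite /N; lia.
  by rewrite fallingSl addrK -TE fallingS mulfK.
rewrite FE topE gE /= -!natr1 pR mE.
field; rewrite F0 e27 !f0 [k%:R + 1]natr1 k1 /=.
by repeat (apply/andP; split); rewrite lt0r_neq0//; lra.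
Qed.

End Coefficients.

(** * Orthogonality *)

Section MomentFunctional.
Context {R : realType}.
Local Open Scope complex_scope.
Implicit Types (f : {poly R[i]}) (nu : nat -> R).

Definition moment_functional nu f : R[i] := \sum_(m < size f) f`_m * (nu m)%:C.

Lemma moment_functionalE nu f n : (size f <= n)%N ->
  moment_functional nu f = \sum_(m < n) f`_m * (nu m)%:C.
Proof.
move=> fn; rewrite /moment_functional (big_ord_widen n (fun m => f`_m * (nu m)%:C) fn).
rewrite big_mkcond; apply: eq_bigr => m _.
by case: ltnP => // /(nth_default 0) ->; rewrite mul0r.
Qed.

Lemma moment_functional_scalar nu : scalar (moment_functional nu).
Proof.
move=> a f g; pose n := maxn (size f) (size g).
have fn : (size f <= n)%N by exact: leq_maxl.
have gn : (size g <= n)%N by exact: leq_maxr.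
have fgn : (size ((a *: f + g)%R : {poly R[i]}) <= n)%N.
  by rewrite (leq_trans (size_polyD _ _))// geq_max gn (leq_trans (size_scale_leq _ _)).
rewrite !(@moment_functionalE _ _ n)// mulr_sumr -big_split/=.
by apply: eq_bigr => m _; rewrite coefD coefZ mulrDl mulrA.
Qed.

Lemma moment_functionalXn nu n : moment_functional nu 'X^n = (nu n)%:C.
Proof.
rewrite (@moment_functionalE _ _ n.+1) ?size_polyXn// big_ord_recr/= coefXn eqxx mul1r.
by rewrite big1 ?add0r// => m _; rewrite coefXn ltn_eqF// mul0r.
Qed.

End MomentFunctional.

Lemma sum_mod3 (V : nmodType) (F : nat -> V) (e n : nat) : (e < 3)%N ->
  (forall m, (m %% 3)%N != e -> F m = 0) ->
  \sum_(m < (3 * n + e).+1) F m = \sum_(j < n.+1) F (3 * j + e)%N.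
Proof.
move=> e3 F0; elim: n => [|n IH].
  rewrite muln0 add0n big_ord_recr big_ord1 /= big1 ?add0r// => m _.
  by rewrite F0// modn_small ?ltn_eqF// (ltn_trans (ltn_ord m)).
rewrite [RHS]big_ord_recr/= -IH (_ : (3 * n.+1 + e).+1 = (3 * n + e).+1.+3)%N; last lia.
rewrite !big_ord_recr/= [F (3 * n + e).+1]F0 ?[F (3 * n + e).+2]F0 ?addr0; [|lia..].
by congr (_ + F _); lia.
Qed.

Lemma nat_ind3 (Q : nat -> Prop) : Q 0%N -> Q 1%N -> Q 2%N ->
  (forall n, Q n -> Q n.+1 -> Q n.+2 -> Q n.+3) -> forall n, Q n.
Proof.
move=> Q0 Q1 Q2 QS n; suff: [/\ Q n, Q n.+1 & Q n.+2] by case.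
by elim: n => [|n [? ? ?]]; split=> //; exact: QS.
Qed.

Section TwoOrthogonalPolynomials.
Context {R : realType}.
Local Open Scope complex_scope.
Variables (rho : R) (rho_gt0 : 0 < rho) (gamma : nat -> R).
Hypothesis gamma_even : forall n : nat, (1 <= n)%N ->
  gamma (2 * n)%N = (2 * n%:R * (2 * n%:R + 1)) / (3 * (3 * n%:R + rho)).
Hypothesis gamma_odd : forall n : nat,
  gamma (2 * n + 1)%N = (2 * (n%:R + 1) * (2 * n%:R + 1) * (n%:R + rho)) /
    (3 * (3 * n%:R + rho) * (3 * n%:R + rho + 3)).
Variable P : nat -> {poly R[i]}.
Hypotheses (P0 : P 0%N = 1) (P1 : P 1%N = 'X) (P2 : P 2%N = 'X^2).
Hypothesis P_rec : forall n : nat, (2 <= n)%N ->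
  P n.+1 = 'X * P n - (gamma (n - 1)%N)%:C *: P (n - 2)%N.
Implicit Types (m n k N : nat).

Lemma P_recS n : P n.+3 = 'X * P n.+2 - (gamma n.+1)%:C *: P n.
Proof. by rewrite P_rec// subn1 subn2. Qed.

(** Induction along the recurrence, matched by [pcoef_rec]. The second clause covers both exponents
    above [N] and those in another class modulo 3. *)
Lemma P_coef N m :
  (forall k, (m + 3 * k)%N = N -> (P N)`_m = (pcoef rho m k)%:C) /\
  ((forall k, (m + 3 * k)%N <> N) -> (P N)`_m = 0).
Proof.
have base n : P n = 'X^n -> (n < 3)%N -> forall m,
  (forall k, (m + 3 * k)%N = n -> (P n)`_m = (pcoef rho m k)%:C) /\
  ((forall k, (m + 3 * k)%N <> n) -> (P n)`_m = 0).
  move=> -> n3 {}m; rewrite coefXn; split=> [k mk|nmk].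
    have k0 : k = 0%N by lia.
    by move: mk; rewrite k0 muln0 addn0 => ->; rewrite eqxx pcoef0 rmorph1.
  by case: eqP => // mn; have := nmk 0%N; rewrite muln0 addn0 mn.
elim/nat_ind3: N m => [||| n IH _ IH2] m.
- exact: base.
- exact: base.
- exact: base.
rewrite P_recS coefB coefXM coefZ; split.
  case=> [|k] mk.
    have -> : m = n.+3 by lia.
    rewrite (proj2 (IH n.+3)); last by lia.
    rewrite (proj1 (IH2 n.+2) 0%N); last by lia.
    by rewrite !pcoef0 mulr0 subr0.
  rewrite (proj1 (IH m) k); last by lia.
  rewrite (pcoef_rec _ rho_gt0 _ gamma_even gamma_odd) (_ : m + 3 * k = n)%N; last by lia.
  rewrite rmorphB; congr (_ - _); last by rewrite -rmorphM.
  case: m mk => [|m] mk //=.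
  by rewrite (proj1 (IH2 m) k.+1)//; lia.
move=> nmk; rewrite (proj2 (IH m)); last by move=> k mk; apply: (nmk k.+1); lia.
rewrite mulr0 subr0; case: m nmk => [//|m] nmk /=.
by rewrite (proj2 (IH2 m))// => k mk; apply: (nmk k); lia.
Qed.

Lemma P_monic_sequence n : P n \is monic /\ size (P n) = n.+1.
Proof.
have lc : (P n)`_n = 1.
  by rewrite (proj1 (P_coef n n) 0%N) ?pcoef0// muln0 addn0.
have sz : size (P n) = n.+1.
  apply/eqP; rewrite eqn_leq; apply/andP; split.
    by apply/leq_sizeP => m nm; rewrite (proj2 (P_coef n m))// => k; lia.
  by rewrite ltnNge; apply/negP => /leq_sizeP/(_ n (leqnn n))/eqP; rewrite lc oner_eq0.
by split=> //; rewrite monicE lead_coefE sz /= lc.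
Qed.

Lemma P_threefold_symmetric : threefold_symmetric P.
Proof.
have [w3 _] := @omega_root R.
move=> n x; elim/nat_ind3: n => [||| n IH _ IH2].
- by rewrite P0 !hornerC expr0 mul1r.
- by rewrite P1 !hornerX expr1.
- by rewrite P2 !hornerXn exprMn.
rewrite P_recS !(hornerE, hornerZ) IH IH2 !exprS.
move: (omega ^+ n) (P n).[x] (P n.+2).[x] => W a b.
by ring: w3.
Qed.

(** If [N] is not congruent to [e] modulo 3, every product of coefficient and moment has a zero
    factor; otherwise the sum is a multiple of a vanishing finite difference. *)
Lemma moment_functional_P_eq0 (nu : nat -> R) (e N : nat) : (e <= 1)%N ->
  (forall m, (m %% 3)%N != e -> nu m = 0) ->
  (forall j, nu (3 * j + e)%N * (j`!%:R * 27 ^+ j * rising (rho / 3 + 1) j) =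
             nu e * (3 * j + e)`!%:R) ->
  (e < N)%N -> moment_functional nu (P N) = 0.
Proof.
move=> e1 nu0 nuE eN; have r0 := rho_gt0.
have [_ szN] := P_monic_sequence N; rewrite (@moment_functionalE _ _ _ N.+1) ?szN//.
have [Ne|Ne] := eqVneq (N %% 3)%N e; last first.
  rewrite big1// => -[m /= _] _; have [me|me] := eqVneq (m %% 3)%N e; last first.
    by rewrite nu0// mulr0.
  by rewrite (proj2 (P_coef N m)) ?mul0r// => k mk; move: Ne me; lia.
pose n := (N %/ 3)%N; have NE : N = (3 * n + e)%N by rewrite /n; lia.
have n1 : (1 <= n)%N by lia.
transitivity (\sum_(m < (3 * n + e).+1) (P N)`_m * (nu m)%:C); first by rewrite -NE.
rewrite (@sum_mod3 _ (fun m => (P N)`_m * (nu m)%:C)); [|lia|]; last first.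
  by move=> m /nu0 ->; rewrite mulr0.
(* For N = 3n + e the start is rho/3 + n + i, and [e <= 1] gives [i < n]. [C] collects what does not
   depend on [j]. *)
pose i := ((n + e).-1)./2; have i_n : (i < n)%N by rewrite /i; lia.
pose C : R := (-1) ^+ n * nu e * N`!%:R / (27 ^+ n * n`!%:R * rising (rho / 3 + 1) (n + i)).
rewrite (eq_bigr (fun j : 'I_n.+1 => (C * ((-1) ^+ j * 'C(n, j)%:R *
    rising (rho / 3 + 1 + j%:R) i))%:C)).
  by rewrite -rmorph_sum -mulr_sumr (alternating_sum_rising _ _ _ i_n) mulr0.
move=> [j /= jn] _; rewrite ltnS in jn.
rewrite (proj1 (P_coef N (3 * j + e)%N) (n - j)%N); last by lia.
rewrite -rmorphM; congr _%:C; rewrite /pcoef.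
rewrite (_ : (3 * j + e + 3 * (n - j))%N = N); last by lia.
have f0 k : k`!%:R != 0 :> R by rewrite pnatr_eq0 -lt0n fact_gt0.
have R0 (x : R) k : 0 < x -> rising x k != 0 by move=> x0; rewrite lt0r_neq0// rising_gt0.
have x0 : 0 < rho / 3 + 1 by lra.
have xj0 : 0 < rho / 3 + 1 + j%:R by rewrite ltr_wpDr.
have e27 k : (27 : R) ^+ k != 0 by rewrite expf_neq0.
have -> : nu (3 * j + e)%N = nu e * (3 * j + e)`!%:R /
    (j`!%:R * 27 ^+ j * rising (rho / 3 + 1) j).
  by rewrite -nuE mulfK// !mulf_neq0// R0.
have -> : falling_start rho N = rho / 3 + (j + i)%:R + (n - j)%:R.
  by rewrite /falling_start -addrA -natrD; congr (_ + _%:R); rewrite NE /i; lia.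
rewrite falling_rising.
(* Of the three blocks, the first is the denominator of the moment and the last that of the
   coefficient; the middle one survives as a polynomial of degree [i] in [j]. *)
have rE : rising (rho / 3 + 1) (n + i) =
    rising (rho / 3 + 1) j * rising (rho / 3 + 1 + j%:R) i *
    rising (rho / 3 + (j + i)%:R + 1) (n - j).
  rewrite -risingD (_ : n + i = j + i + (n - j))%N; last by lia.
  by rewrite risingD addrAC.
have bE : 'C(n, j)%:R = n`!%:R / (j`!%:R * (n - j)`!%:R) :> R.
  by rewrite -(bin_fact jn) !natrM mulfK// mulf_neq0.
have sE : (-1) ^+ (n - j) = (-1) ^+ n * (-1) ^+ j :> R.
  by rewrite -signr_odd oddB// signr_addb !signr_odd.
rewrite /C rE bE sE -[in 27 ^+ n](subnK jn) exprD.
have y0 : 0 < rho / 3 + (j + i)%:R + 1 by rewrite ltr_wpDl// addr_ge0//; lra.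
by field; rewrite !f0 !e27 !R0.
Qed.

(** Since x P_(n+2) = P_(n+3) + gamma_(n+1) P_n, each extra power of x costs two in the index. At
    the critical index only the gamma term survives, and it is nonzero. *)
Lemma orthogonality_from_recurrence (u : {poly R[i]} -> R[i]) (e : nat) :
  (e <= 1)%N -> scalar u ->
  (forall n, (e < n)%N -> u (P n) = 0) -> u (P e) != 0 -> forall m,
  (forall n, (2 * m + e.+1 <= n)%N -> u ('X^m * P n) = 0) /\
  u ('X^m * P (2 * m + e)%N) != 0.
Proof.
move=> e1 uL uP ue; elim=> [|m [IH0 IH]].
  by rewrite muln0 add0n expr0 mul1r; split=> // n en; rewrite mul1r uP.
have step n : u ('X^(m.+1) * P n.+2) =
    (gamma n.+1)%:C * u ('X^m * P n) + u ('X^m * P n.+3).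
  by rewrite -uL; congr u; rewrite P_recS exprSr -mulrA scalerAr -mulrDr addrC subrK.
split=> [n|].
  case: n => [|[|n]]; [lia..|] => mn.
  by rewrite step !IH0 ?mulr0 ?addr0//; lia.
rewrite (_ : 2 * m.+1 + e = (2 * m + e).+2)%N; last by lia.
rewrite step [X in _ + X]IH0 ?addr0; last by lia.
rewrite mulf_neq0// -[0]/(0%:C) (inj_eq (@complexI R)) lt0r_neq0//.
exact: (gamma_gt0 _ rho_gt0 _ gamma_even gamma_odd).
Qed.

End TwoOrthogonalPolynomials.

(** * Closed form of the moments *)

Section MomentClosedForm.
Context {R : realType}.
Variables (rho : R) (M : nat -> R) (e : nat).
Hypothesis e1 : (e <= 1)%N.
Hypothesis M_rec : forall j : nat,
  3 * (rho + (3 * j + 3)%N%:R) * (3 * j + 3)%N%:R * M (3 * j + e + 3) =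
  (3 * j + e).+3%:R * (3 * j + e).+2%:R * (3 * j + e).+1%:R * M (3 * j + e).

(** The step uses 3(rho+3j+3)(3j+3) = 27(j+1)(rho/3+1+j); in the base case [e <= 1] gives e! = 1. *)
Lemma moment_closed_form (j : nat) :
  M (3 * j + e) * (j`!%:R * 27 ^+ j * rising (rho / 3 + 1) j) =
  M e * (3 * j + e)`!%:R.
Proof.
elim: j => [|j IH].
  rewrite muln0 add0n fact0 expr0 rising0 !mulr1.
  by case: e e1 => [|[|//]] _; rewrite ?fact0 ?fact1 mulr1.
have -> : (3 * j.+1 + e = 3 * j + e + 3)%N by lia.
rewrite [in RHS]addn3 !factS !natrM.
transitivity ((3 * j + e).+3%:R * (3 * j + e).+2%:R * (3 * j + e).+1%:R *
  (M (3 * j + e) * (j`!%:R * 27 ^+ j * rising (rho / 3 + 1) j))).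
  by rewrite [RHS]mulrA -M_rec risingS exprS natrD natrM -natr1; field.
by rewrite IH; ring.
Qed.

End MomentClosedForm.

(** * Orthogonality for the integral functionals *)

Section Functionals.
Context {R : realType}.
Local Open Scope complex_scope.
Implicit Types (rho : R) (f : {poly R[i]}).

Let nu (U : R -> R) k m : R := (3 %| m + 2 * k)%N%:R * moment U m.

Let functional_nu U k f : moments_converge U -> (k <= 1)%N ->
  functional k U f = moment_functional (nu U k) f.
Proof. by move=> iU k1; have [_ ->] := functional_momentsE U f k iU k1. Qed.

Let nu_on U k j : (k <= 1)%N -> nu U k (3 * j + k) = moment U (3 * j + k).
Proof. by move=> k1; rewrite /nu (_ : 3 %| _)%N ?mul1r//; lia. Qed.

Let nu_self U k : (k <= 1)%N -> nu U k k = moment U k.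
Proof. exact: (nu_on U k 0). Qed.

Let nu_off U k m : (k <= 1)%N -> (m %% 3)%N != k -> nu U k m = 0.
Proof.
by move=> k1 mk; rewrite /nu (_ : (3 %| _)%N = false) ?mul0r//; apply/negbTE; lia.
Qed.

Section Weight.
Variables (rho : R) (rho_gt0 : 0 < rho) (gamma : nat -> R).
Hypothesis gamma_even : forall n : nat, (1 <= n)%N ->
  gamma (2 * n)%N = (2 * n%:R * (2 * n%:R + 1)) / (3 * (3 * n%:R + rho)).
Hypothesis gamma_odd : forall n : nat,
  gamma (2 * n + 1)%N = (2 * (n%:R + 1) * (2 * n%:R + 1) * (n%:R + rho)) /
    (3 * (3 * n%:R + rho) * (3 * n%:R + rho + 3)).
Variable P : nat -> {poly R[i]}.
Hypotheses (P0 : P 0%N = 1) (P1 : P 1%N = 'X) (P2 : P 2%N = 'X^2).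
Hypothesis P_rec : forall n : nat, (2 <= n)%N ->
  P n.+1 = 'X * P n - (gamma (n - 1)%N)%:C *: P (n - 2)%N.
Variables (U : R -> R) (k : nat).
Hypotheses (k1 : (k <= 1)%N) (iU : moments_converge U).
Hypothesis MU_gt0 : forall n, 0 < moment U n.
Hypothesis MU_rec : forall j : nat,
  3 * (rho + (3 * j + 3)%N%:R) * (3 * j + 3)%N%:R * moment U (3 * j + k + 3) =
  (3 * j + k).+3%:R * (3 * j + k).+2%:R * (3 * j + k).+1%:R * moment U (3 * j + k).

Lemma functional_scalar : scalar (functional k U).
Proof. by move=> a f g; rewrite !functional_nu//; exact: moment_functional_scalar. Qed.

Lemma functional_orthogonality m :
  (forall n, (2 * m + k.+1 <= n)%N -> functional k U ('X^m * P n) = 0) /\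
  functional k U ('X^m * P (2 * m + k)%N) != 0.
Proof.
apply: (orthogonality_from_recurrence rho rho_gt0 gamma gamma_even gamma_odd P P_rec) => //.
- exact: functional_scalar.
- move=> n kn; rewrite functional_nu//.
  apply: (moment_functional_P_eq0 rho rho_gt0 gamma gamma_even gamma_odd P P0 P1 P2 P_rec
    (nu U k) k n k1) => //.
    by move=> l; exact: nu_off.
  by move=> j; rewrite nu_on// nu_self// moment_closed_form.
- have -> : P k = 'X^k by case: k k1 => [|[|//]] _; rewrite ?P0 ?P1 ?expr0 ?expr1.
  rewrite functional_nu// moment_functionalXn nu_self//.
  by rewrite -[0]/(0%:C) (inj_eq (@complexI R)) lt0r_neq0.
Qed.

End Weight.
End Functionals.

Local Open Scope complex_scope.

Theorem proposition3p12 (R : realType) (rho : R) (rho_gt0 : 0 < rho)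
    (gamma : nat -> R)
    (gamma_even : forall n : nat, (1 <= n)%N ->
      gamma (2 * n)%N =
        (2 * n%:R * (2 * n%:R + 1)) / (3 * (3 * n%:R + rho)))
    (gamma_odd : forall n : nat,
      gamma (2 * n + 1)%N =
        (2 * (n%:R + 1) * (2 * n%:R + 1) * (n%:R + rho)) /
        (3 * (3 * n%:R + rho) * (3 * n%:R + rho + 3)))
    (P : nat -> {poly R[i]})
    (P0 : P 0%N = 1) (P1 : P 1%N = 'X) (P2 : P 2%N = 'X^2)
    (P_rec : forall n : nat, (2 <= n)%N ->
      P n.+1 = 'X * P n - (gamma (n - 1)%N)%:C *: P (n - 2)%N) :
  [/\ threefold_symmetric P,
      (forall f : {poly R[i]}, functional_converges (calU0 rho) f),
      (forall f : {poly R[i]}, functional_converges (calU1 rho) f) &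
      two_orthogonal P (functional 0 (calU0 rho)) (functional 1 (calU1 rho))].
Proof.
have [c0 pos0 rec0] := calU0_moments rho rho_gt0.
have [c1 pos1 rec1] := calU1_moments rho rho_gt0.
split.
- exact: P_threefold_symmetric P0 P1 P2 P_rec.
- by move=> f; have [] := functional_momentsE (calU0 rho) f 0 c0 isT.
- by move=> f; have [] := functional_momentsE (calU1 rho) f 1 c1 isT.
split.
- exact: (P_monic_sequence rho rho_gt0 gamma gamma_even gamma_odd P P0 P1 P2 P_rec).
- exact: functional_scalar.
- exact: functional_scalar.
- move=> m; have := functional_orthogonality rho rho_gt0 gamma gamma_even gamma_odd P
    P0 P1 P2 P_rec (calU0 rho) 0 isT c0 pos0 _ m.
  rewrite addn0; apply => j; rewrite addn0.
  (* The recurrence at n = 3j lacks the factor n + 3 = 3j + 3 of the common form. *)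
  transitivity ((3 * j + 3)%:R * (3 * (rho + (3 * j).+3%:R) * moment (calU0 rho) (3 * j + 3))).
    by rewrite -addn3; ring.
  by rewrite rec0 addn3; ring.
- move=> m; have := functional_orthogonality rho rho_gt0 gamma gamma_even gamma_odd P
    P0 P1 P2 P_rec (calU1 rho) 1 isT c1 pos1 _ m.
  apply => j.
  (* At n = 3j + 1 the missing factor is n + 2, again 3j + 3. *)
  transitivity ((3 * j + 3)%:R * (3 * (rho + (3 * j + 1).+2%:R) * moment (calU1 rho) (3 * j + 1 + 3))).
    by rewrite (_ : (3 * j + 1).+2 = 3 * j + 3)%N; [ring|lia].
  by rewrite rec1 (_ : (3 * j + 3)%N = (3 * j + 1).+2); [ring|lia].
Qed.
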